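(* Let $\alpha>-1$ and $\beta>-1$ be real. There exist unique real sequences $(a_0(n))_{n\ge 0}$, $(b_0(n))_{n\ge 0}$, $(c_0(n))_{n\ge 0}$ (not depending on $x$, $M$, $N$) and unique functions $a_i,b_i,c_i:\mathbb{R}\to\mathbb{R}$, $i=1,2,3,\ldots$ (not depending on $n$, $M$, $N$) such that for all $M\ge 0$, all $N\ge 0$, all $n\in\{0,1,2,\ldots\}$ and all $x\in\mathbb{R}$ the generalized Jacobi polynomial $y(x)=P_n^{\alpha,\beta,M,N}(x)$ satisfies $$M\Big(a_0(n)y(x)+\sum_{i=1}^{\infty}a_i(x)y^{(i)}(x)\Big)+N\Big(b_0(n)y(x)+\sum_{i=1}^{\infty}b_i(x)y^{(i)}(x)\Big)+MN\Big(c_0(n)y(x)+\sum_{i=1}^{\infty}c_i(x)y^{(i)}(x)\Big)$$ $$+(1-x^2)y''(x)+\left[\beta-\alpha-(\alpha+\beta+2)x\right]y'(x)+n(n+\alpha+\beta+1)y(x)=0.$$ Moreover, these coefficients are given by the following formulas. (1) $a_0(0)=b_0(0)=c_0(0)=c_0(1)=0$; for $n\ge 1$ $$a_0(n)=(\alpha+\beta+2)\frac{(\beta+3)_{n-1}(\alpha+\beta+3)_{n-1}}{(\alpha+1)_{n-1}\,(n-1)!},\qquad b_0(n)=(\alpha+\beta+2)\frac{(\alpha+3)_{n-1}(\alpha+\beta+3)_{n-1}}{(\beta+1)_{n-1}\,(n-1)!};$$ and for $n\ge 2$ $$c_0(n)=\frac{(\alpha+\beta+2)^2(\alpha+\beta+3)}{(\alpha+1)(\beta+1)}\,\frac{(\alpha+\beta+4)_{n-1}}{(n-1)!}\,\frac{(\alpha+\beta+4)_{n-2}}{(n-2)!}.$$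 (2) For $i=1,2,3,\ldots$ $$a_i(x)=-(\alpha+\beta+2)2^i\sum_{\ell=0}^{i-1}(-1)^{\ell}\frac{(\beta+3)_{i-\ell-1}(-\beta-2)_{i-\ell-1}}{(\alpha+1)_{i-\ell-1}\,(i-\ell)!\,(i-\ell-1)!\,\ell!}\;{}_3F_2\!\left(\left.{-\ell,\ \alpha+\beta+3,\ \beta+i-\ell+2\atop \alpha+i-\ell,\ i-\ell+1}\right|1\right)\left(\frac{x+1}{2}\right)^{\ell+1},$$ $$b_i(x)=(\alpha+\beta+2)(-2)^i\sum_{\ell=0}^{i-1}\frac{(\alpha+3)_{i-\ell-1}(-\alpha-2)_{i-\ell-1}}{(\beta+1)_{i-\ell-1}\,(i-\ell)!\,(i-\ell-1)!\,\ell!}\;{}_3F_2\!\left(\left.{-\ell,\ \alpha+\beta+3,\ \alpha+i-\ell+2\atop \beta+i-\ell,\ i-\ell+1}\right|1\right)\left(\frac{x-1}{2}\right)^{\ell+1}.$$ (3) $c_1(x)=0$, and for $i=2,3,4,\ldots$ one has $c_i(x)=c_i^{(1)}(x)+c_i^{(2)}(x)$, where $$c_i^{(1)}(x)=-\frac{(\alpha+\beta+2)^2(\alpha+\beta+3)(\alpha+\beta+4)}{(\alpha+1)(\beta+1)\,i}(x^2-1)2^{i-2}\sum_{\ell=0}^{i-2}(-1)^{\ell}\frac{(\beta+3)_{i-\ell-2}(-\alpha-\beta-3)_{i-\ell-2}}{(i-\ell-1)!\,(i-\ell-2)!\,\ell!\,(i-\ell-1)!}$$ $$\times\;{}_4F_3\!\left(\left.{-\ell,\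 \alpha+\beta+5,\ \alpha+\beta+4,\ \beta+i-\ell+1\atop \beta+3,\ i-\ell,\ i-\ell}\right|1\right)\left(\frac{x+1}{2}\right)^{\ell+1},$$ $$c_i^{(2)}(x)=\frac{(\alpha+\beta+2)^2(\alpha+\beta+3)(\alpha+\beta+4)}{(\alpha+1)(\beta+1)\,i}(x^2-1)(-2)^{i-2}\sum_{\ell=0}^{i-2}\frac{(\alpha+3)_{i-\ell-2}(-\alpha-\beta-3)_{i-\ell-2}}{(i-\ell-1)!\,(i-\ell-2)!\,\ell!\,(i-\ell-1)!}$$ $$\times\;{}_4F_3\!\left(\left.{-\ell,\ \alpha+\beta+5,\ \alpha+\beta+4,\ \alpha+i-\ell+1\atop \alpha+3,\ i-\ell,\ i-\ell}\right|1\right)\left(\frac{x-1}{2}\right)^{\ell+1}.$$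
   Context: Notation: $(a)_0=1$, $(a)_k=a(a+1)\cdots(a+k-1)$ for $k\ge 1$ (Pochhammer symbol). ${}_pF_q\left(\left.{a_1,\ldots,a_p\atop b_1,\ldots,b_q}\right|z\right)=\sum_{k\ge 0}\frac{(a_1)_k\cdots(a_p)_k}{(b_1)_k\cdots(b_q)_k}\frac{z^k}{k!}$ is the hypergeometric series; with a numerator parameter $-\ell$, $\ell\in\{0,1,2,\ldots\}$, it is a finite sum over $0\le k\le\ell$. $D=\frac{d}{dx}$. Since $y$ is a polynomial, the sums over $i$ in the differential equation have only finitely many nonzero terms. Classical Jacobi polynomials: for $n=0,1,2,\ldots$ $$P_n^{(\alpha,\beta)}(x)=\sum_{k=0}^n\frac{(n+\alpha+\beta+1)_k}{k!}\frac{(\alpha+k+1)_{n-k}}{(n-k)!}\left(\frac{x-1}{2}\right)^k.$$ Generalized Jacobi polynomials: for $\alpha>-1$, $\beta>-1$, $M\ge 0$, $N\ge 0$ they are the polynomials $P_n^{\alpha,\beta,M,N}(x)$ of degree $n$, $n=0,1,2,\ldots$, orthogonal on $[-1,1]$ with respect to the weight $$\frac{\Gamma(\alpha+\beta+2)}{2^{\alpha+\beta+1}\Gamma(\alpha+1)\Gamma(\beta+1)}(1-x)^{\alpha}(1+x)^{\beta}+M\delta(x+1)+N\delta(x-1),$$ normalized so that (Koornwinder's representation) $$P_n^{\alpha,\beta,M,N}(x)=P_n^{(\alpha,\beta)}(x)+MQ_n^{(\alpha,\beta)}(x)+NR_n^{(\alpha,\beta)}(x)+MN\,S_n^{(\alpha,\beta)}(x),$$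 where $Q_0^{(\alpha,\beta)}=R_0^{(\alpha,\beta)}=S_0^{(\alpha,\beta)}=0$ and for $n\ge 1$ $$Q_n^{(\alpha,\beta)}(x)=\frac{(\beta+2)_{n-1}(\alpha+\beta+2)_{n-1}}{(\alpha+1)_n\,n!}\left[n(n+\alpha+\beta+1)P_n^{(\alpha,\beta)}(x)-(\beta+1)(x-1)DP_n^{(\alpha,\beta)}(x)\right],$$ $$R_n^{(\alpha,\beta)}(x)=\frac{(\alpha+2)_{n-1}(\alpha+\beta+2)_{n-1}}{(\beta+1)_n\,n!}\left[n(n+\alpha+\beta+1)P_n^{(\alpha,\beta)}(x)-(\alpha+1)(x+1)DP_n^{(\alpha,\beta)}(x)\right],$$ $$S_n^{(\alpha,\beta)}(x)=\frac{(\alpha+\beta+2)_n(\alpha+\beta+2)_{n-1}}{(\alpha+1)(\beta+1)\,n!\,(n-1)!}\left[n(n+\alpha+\beta+1)P_n^{(\alpha,\beta)}(x)-\{(\beta+1)(x-1)+(\alpha+1)(x+1)\}DP_n^{(\alpha,\beta)}(x)\right].$$ *)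

(* Defs.v *)
From mathcomp Require Import all_boot all_order all_algebra.
From mathcomp Require Import all_classical all_reals topology normedtype.
From mathcomp Require Import sequences.
Import Order.TTheory GRing.Theory Num.Theory.
Import numFieldNormedType.Exports.

Set Implicit Arguments.
Unset Strict Implicit.
Unset Printing Implicit Defensive.

Local Open Scope ring_scope.

(* (a)_k = a (a + 1) ... (a + k - 1) *)
Definition poch (R : realType) (a : R) (k : nat) : R :=
  \prod_(j < k) (a + j%:R).

Definition hyp_term (R : realType) (num den : seq R) (z : R) (k : nat) : R :=
  (\prod_(a <- num) poch a k) / (\prod_(b <- den) poch b k)
  * (z ^+ k / k`!%:R).

Definition pFq (R : realType) (num den : seq R) (z : R) : R :=
  \big[+%R/0]_(0 <= k <oo) hyp_term num den z k.

Section Polynomials.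
Variable R : realType.
Implicit Types (alpha beta M N : R) (n : nat).

Definition jacobi alpha beta n : {poly R} :=
  \sum_(k < n.+1)
    (poch (n%:R + alpha + beta + 1) k / k`!%:R
     * (poch (alpha + k%:R + 1) (n - k) / (n - k)`!%:R))
    *: (2^-1 *: ('X - 1)) ^+ k.

Definition jacobiQ alpha beta n : {poly R} :=
  if n == 0%N then 0 else
  (poch (beta + 2) n.-1 * poch (alpha + beta + 2) n.-1
   / (poch (alpha + 1) n * n`!%:R))
  *: ((n%:R * (n%:R + alpha + beta + 1)) *: jacobi alpha beta n
      - (beta + 1) *: (('X - 1) * (jacobi alpha beta n)^`())).

Definition jacobiR alpha beta n : {poly R} :=
  if n == 0%N then 0 else
  (poch (alpha + 2) n.-1 * poch (alpha + beta + 2) n.-1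
   / (poch (beta + 1) n * n`!%:R))
  *: ((n%:R * (n%:R + alpha + beta + 1)) *: jacobi alpha beta n
      - (alpha + 1) *: (('X + 1) * (jacobi alpha beta n)^`())).

Definition jacobiS alpha beta n : {poly R} :=
  if n == 0%N then 0 else
  (poch (alpha + beta + 2) n * poch (alpha + beta + 2) n.-1
   / ((alpha + 1) * (beta + 1) * n`!%:R * (n.-1)`!%:R))
  *: ((n%:R * (n%:R + alpha + beta + 1)) *: jacobi alpha beta n
      - ((beta + 1) *: ('X - 1) + (alpha + 1) *: ('X + 1))
        * (jacobi alpha beta n)^`()).

(* Koornwinder's representation, which fixes both the orthogonal polynomials
   for the weight with point masses M at -1 and N at 1 and their
   normalization. *)
Definition gen_jacobi alpha beta M N n : {poly R} :=
  jacobi alpha beta n + M *: jacobiQ alpha beta n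
  + N *: jacobiR alpha beta n + (M * N) *: jacobiS alpha beta n.

End Polynomials.

(* a0(n) y(x) + sum_(i >= 1) a_i(x) y^(i)(x); the value of a at index 0 is
   not used. *)
Definition diff_op (R : realType) (a0 : nat -> R) (a : nat -> R -> R)
    (n : nat) (y : {poly R}) (x : R) : R :=
  a0 n * y.[x] + \big[+%R/0]_(1 <= i <oo) (a i x * y^`(i).[x]).

Definition satisfies_diff_eq (R : realType) (alpha beta : R)
    (a0 b0 c0 : nat -> R) (a b c : nat -> R -> R) : Prop :=
  forall (M N : R) (n : nat) (x : R), 0 <= M -> 0 <= N ->
  let y := gen_jacobi alpha beta M N n in
  M * diff_op a0 a n y x + N * diff_op b0 b n y x
  + M * N * diff_op c0 c n y x
  + (1 - x ^+ 2) * y^`(2).[x]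
  + (beta - alpha - (alpha + beta + 2) * x) * y^`().[x]
  + n%:R * (n%:R + alpha + beta + 1) * y.[x] = 0.

(* The natural number subtractions i - l - 1, i - l - 2, ... below are never
   truncated in the range of summation. *)
Section Coefficients.
Variables (R : realType) (alpha beta : R).
Implicit Types (n i : nat) (x : R).

Definition coef_a0 n : R :=
  if n == 0%N then 0 else
  (alpha + beta + 2)
  * (poch (beta + 3) n.-1 * poch (alpha + beta + 3) n.-1
     / (poch (alpha + 1) n.-1 * (n.-1)`!%:R)).

Definition coef_b0 n : R :=
  if n == 0%N then 0 else
  (alpha + beta + 2)
  * (poch (alpha + 3) n.-1 * poch (alpha + beta + 3) n.-1
     / (poch (beta + 1) n.-1 * (n.-1)`!%:R)).

Definition coef_c0 n : R :=
  if (n <= 1)%N then 0 else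
  (alpha + beta + 2) ^+ 2 * (alpha + beta + 3) / ((alpha + 1) * (beta + 1))
  * (poch (alpha + beta + 4) n.-1 / (n.-1)`!%:R)
  * (poch (alpha + beta + 4) (n - 2) / (n - 2)`!%:R).

Definition coef_a i x : R :=
  - (alpha + beta + 2) * 2 ^+ i *
  \sum_(l < i)
    (-1) ^+ l
    * (poch (beta + 3) (i - l - 1) * poch (- beta - 2) (i - l - 1)
       / (poch (alpha + 1) (i - l - 1)
          * (i - l)`!%:R * (i - l - 1)`!%:R * l`!%:R))
    * pFq [:: - l%:R; alpha + beta + 3; beta + (i - l)%:R + 2]
          [:: alpha + (i - l)%:R; (i - l)%:R + 1] 1
    * ((x + 1) / 2) ^+ l.+1.

Definition coef_b i x : R :=
  (alpha + beta + 2) * (-2) ^+ i *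
  \sum_(l < i)
    (poch (alpha + 3) (i - l - 1) * poch (- alpha - 2) (i - l - 1)
     / (poch (beta + 1) (i - l - 1)
        * (i - l)`!%:R * (i - l - 1)`!%:R * l`!%:R))
    * pFq [:: - l%:R; alpha + beta + 3; alpha + (i - l)%:R + 2]
          [:: beta + (i - l)%:R; (i - l)%:R + 1] 1
    * ((x - 1) / 2) ^+ l.+1.

Definition coef_c1 i x : R :=
  - ((alpha + beta + 2) ^+ 2 * (alpha + beta + 3) * (alpha + beta + 4)
     / ((alpha + 1) * (beta + 1) * i%:R))
  * (x ^+ 2 - 1) * 2 ^+ (i - 2) *
  \sum_(l < i.-1)
    (-1) ^+ l
    * (poch (beta + 3) (i - l - 2) * poch (- alpha - beta - 3) (i - l - 2)
       / ((i - l - 1)`!%:R * (i - l - 2)`!%:R * l`!%:R * (i - l - 1)`!%:R))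
    * pFq [:: - l%:R; alpha + beta + 5; alpha + beta + 4;
              beta + (i - l)%:R + 1]
          [:: beta + 3; (i - l)%:R; (i - l)%:R] 1
    * ((x + 1) / 2) ^+ l.+1.

Definition coef_c2 i x : R :=
  (alpha + beta + 2) ^+ 2 * (alpha + beta + 3) * (alpha + beta + 4)
  / ((alpha + 1) * (beta + 1) * i%:R)
  * (x ^+ 2 - 1) * (-2) ^+ (i - 2) *
  \sum_(l < i.-1)
    (poch (alpha + 3) (i - l - 2) * poch (- alpha - beta - 3) (i - l - 2)
     / ((i - l - 1)`!%:R * (i - l - 2)`!%:R * l`!%:R * (i - l - 1)`!%:R))
    * pFq [:: - l%:R; alpha + beta + 5; alpha + beta + 4;
              alpha + (i - l)%:R + 1]
          [:: alpha + 3; (i - l)%:R; (i - l)%:R] 1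
    * ((x - 1) / 2) ^+ l.+1.

Definition coef_c i x : R :=
  if (i <= 1)%N then 0 else coef_c1 i x + coef_c2 i x.

End Coefficients.

Lemma limn_big_finite (R : realType) (m K : nat) (F : nat -> R) :
  (m <= K)%N -> (forall k, (K <= k)%N -> F k = 0) ->
  \big[+%R/0]_(m <= k <oo) F k = \sum_(m <= k < K) F k.
Proof.
move=> mK F0; apply: lim_near_cst => //.
near=> n.
have Kn : (K <= n)%N by near: n; exact: nbhs_infty_ge.
rewrite (big_cat_nat mK Kn) /= [X in _ + X]big_nat_cond.
rewrite [X in _ + X]big1 ?addr0 // => k /andP[/andP[Kk _] _].
exact: F0.
Unshelve. all: by end_near. Qed.

Lemma pFq_terminating (R : realType) (l : nat) (num den : seq R) (z : R) :
  pFq (- l%:R :: num) den z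
  = \sum_(k < l.+1) hyp_term (- l%:R :: num) den z k.
Proof.
rewrite /pFq (@limn_big_finite _ 0 l.+1) ?big_mkord // => k lk.
rewrite /hyp_term big_cons /poch (bigD1 (Ordinal lk)) //=.
by rewrite addNr !mul0r.
Qed.

Lemma diff_opE (R : realType) (a0 : nat -> R) (a : nat -> R -> R)
    (n : nat) (y : {poly R}) (x : R) :
  diff_op a0 a n y x
  = a0 n * y.[x] + \sum_(1 <= i < (size y).+1) a i x * y^`(i).[x].
Proof.
rewrite /diff_op (@limn_big_finite _ 1 (size y).+1) // => k yk.
by rewrite derivn_poly0 ?hornerE ?mulr0 // ltnW.
Qed.

(* Main.v *)
From HB Require Import structures.
Require Import Defs.
From mathcomp Require Import all_boot all_order all_algebra.
From mathcomp Require Import all_reals ring lra zify.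
Import Order.TTheory GRing.Theory Num.Theory.

Set Implicit Arguments.
Unset Strict Implicit.
Unset Printing Implicit Defensive.

Local Open Scope ring_scope.

(** In the variable t = (x + 1) / 2 the formal operators sum_i a_i(x) D^i and
    sum_i b_i(x) D^i become explicit operators A and B on polynomials: summing
    the powers (-t)^(i-r) / (i-r)! against D^i is Taylor's formula at t = 0, so
    A is given by its values on the monomials t^r, and B is the image of A under
    the reflection t -> 1 - t, which exchanges alpha and beta.  The operator C
    of the c_i is treated through its commutator with t, which removes the
    factors 1/i and is again a sum of two reflected operators with known values
    on monomials.

    Let L be the Jacobi operator and <.,.> the inner product given by the Jacobi
    weight and the masses M, N at the end points.  The Pfaff-Saalschuetz sum
    shows that <A t^r, t^s> is symmetric up to a boundary term, and Euler's
    transformation of 2F1 does the same for the commutator of C.  The boundary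
    terms cancel in L + M A + N B + M N C, which is therefore symmetric for
    <.,.>.  It is also triangular on monomials, with diagonal entries
    -(n(n+alpha+beta+1) + M a_0(n) + N b_0(n) + M N c_0(n)), so it has the
    orthogonal polynomials as eigenvectors; this is the differential equation.

    For uniqueness, compare two solutions as polynomials in M and N and use
    induction on n: P_n and Q_n are linearly independent, as Q_n vanishes at -1
    but not at 1 and P_n does not vanish at -1; similarly P_n and R_n. *)

(** * Hypergeometric summation *)

Section Pochhammer.
Variable R : realType.
Implicit Types (a b c : R) (k m n : nat) (u v w : nat -> R).

Lemma poch0 a : poch a 0 = 1.
Proof. by rewrite /poch big_ord0. Qed.

Lemma pochS a k : poch a k.+1 = poch a k * (a + k%:R).
Proof. by rewrite /poch big_ord_recr. Qed.

Lemma poch1 a : poch a 1 = a.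
Proof. by rewrite pochS poch0 mul1r addr0. Qed.

Lemma pochD a m n : poch a (m + n) = poch a m * poch (a + m%:R) n.
Proof.
elim: n => [|n IH]; first by rewrite addn0 poch0 mulr1.
by rewrite addnS !pochS IH natrD; ring.
Qed.

Lemma pochSl a k : poch a k.+1 = a * poch (a + 1) k.
Proof. by rewrite -add1n pochD poch1. Qed.

Lemma poch_gt0 a k : 0 < a -> 0 < poch a k.
Proof.
move=> a0; elim: k => [|k IH]; first by rewrite poch0.
by rewrite pochS mulr_gt0 // ltr_wpDr // ler0n.
Qed.

Lemma poch_neq0 a k : 0 < a -> poch a k != 0.
Proof. by move=> a0; rewrite gt_eqF ?poch_gt0. Qed.

Lemma fact_neq0 n : n`!%:R != 0 :> R.
Proof. by rewrite pnatr_eq0 -lt0n fact_gt0. Qed.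

Lemma factSr n : n.+1`!%:R = n.+1%:R * n`!%:R :> R.
Proof. by rewrite factS natrM. Qed.

Lemma natS_neq0 n : 1 + n%:R != 0 :> R.
Proof. by rewrite nat1r pnatr_eq0. Qed.

Lemma poch_fact n m : poch (n.+1%:R : R) m = (n + m)`!%:R / n`!%:R.
Proof.
elim: m => [|m IH]; first by rewrite poch0 addn0 divff ?fact_neq0.
rewrite pochS IH addnS factSr -[(n + m).+1]addSn natrD.
by field; rewrite fact_neq0.
Qed.

Lemma pochN_fact n m :
  poch (- n%:R : R) m =
  if (m <= n)%N then (-1) ^+ m * n`!%:R / (n - m)`!%:R else 0.
Proof.
elim: m => [|m IH].
  by rewrite poch0 leq0n subn0 expr0 mul1r divff ?fact_neq0.
rewrite pochS IH; case: (ltngtP m n) => [lt_mn|//|->]; last first.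
- by rewrite addNr mulr0.
- by rewrite mul0r.
have -> : (n - m)%N = (n - m.+1).+1 by rewrite -subSn.
rewrite factSr exprS.
have -> : n%:R = m%:R + (n - m.+1).+1%:R :> R.
  by rewrite -natrD -subSn // subSS subnKC // ltnW.
by field; rewrite fact_neq0 natS_neq0.
Qed.

Lemma nat2S_neq0 n : 2 + n%:R != 0 :> R.
Proof. by rewrite -(natrD _ 2) pnatr_eq0. Qed.

(** Coefficient of [z^m] in the product of the generating functions of [u] and [v]. *)
Definition conv u v m : R := \sum_(k < m.+1) u (m - k)%N * v k.

(** Up to index [m] the generating functions may be truncated to polynomials, whose product is
    associative. *)
Lemma convA u v w m : conv u (conv v w) m = conv (conv u v) w m.
Proof.
pose T x : {poly R} := \poly_(i < m.+1) x i.
have Tcoef x y k : (k <= m)%N -> (T x * T y)`_k = conv x y k.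
  move=> km; rewrite coefMr; apply: eq_bigr => i _.
  have im : (i < m.+1)%N by apply: leq_trans (ltn_ord i) _.
  by rewrite !coef_poly im (leq_ltn_trans (leq_subr i k)) ?ltnS.
have -> : conv u (conv v w) m = (T u * (T v * T w))`_m.
  rewrite coefMr; apply: eq_bigr => k _.
  have km : (k <= m)%N by rewrite -ltnS.
  by rewrite Tcoef // coef_poly ltnS leq_subr.
rewrite mulrA coefMr; apply: eq_bigr => k _.
by rewrite Tcoef ?leq_subr // coef_poly ltn_ord.
Qed.

Lemma eq_conv u u' v v' m :
  (forall k, (k <= m)%N -> u k = u' k) -> (forall k, (k <= m)%N -> v k = v' k) ->
  conv u v m = conv u' v' m.
Proof.
move=> eu ev; apply: eq_bigr => k _.
by rewrite eu ?leq_subr // ev // -ltnS.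
Qed.

(** Coefficient of [z^m] in [(1 - z)^(-a)]. *)
Definition binr a m : R := poch a m / m`!%:R.

(** Coefficient of [z^k] in [2F1(a, b; c; z)]. *)
Definition F21 a b c k : R := poch a k * poch b k / (k`!%:R * poch c k).

(** This is the first-order recurrence that the coefficients of [2F1(c - a, c - b; c; z)] satisfy by
    their product form, so it yields Euler's transformation by induction. *)
Lemma Euler_transform_recurrence a b c m : 0 < c ->
  m.+1%:R * (c + m%:R) * conv (binr (c - a - b)) (F21 a b c) m.+1 =
  (c - a + m%:R) * (c - b + m%:R) * conv (binr (c - a - b)) (F21 a b c) m.
Proof.
move=> c0; set e := c - a - b.
(* Wilf-Zeilberger certificate: the summands of the recurrence telescope. *)
pose G k : R := - k%:R * (c + k%:R - 1) * binr e (m.+1 - k) * F21 a b c k.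
have ck k : c + k%:R != 0 by rewrite gt_eqF // ltr_wpDr // ler0n.
apply/eqP; rewrite -subr_eq0 {1}/conv big_ord_recr /= subnn mulrDr addrAC.
rewrite /conv !mulr_sumr -sumrB.
have -> : \sum_(k < m.+1)
   (m.+1%:R * (c + m%:R) * (binr e (m.+1 - k) * F21 a b c k) -
    (c - a + m%:R) * (c - b + m%:R) * (binr e (m - k) * F21 a b c k)) =
  \sum_(0 <= k < m.+1) (G k.+1 - G k).
  rewrite big_mkord; apply: eq_bigr => k _.
  have km : (k <= m)%N by rewrite -ltnS.
  rewrite /G subSS subSn // /binr /F21 !pochS !factSr.
  have -> : m%:R = k%:R + (m - k)%:R :> R by rewrite -natrD subnKC.
  have -> : m.+1%:R = k%:R + (m - k)%:R + 1 :> R.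
    by rewrite -natr1 -natrD subnKC.
  rewrite /e; move: (m - k)%N => i; have := ck k; have := poch_neq0 k c0.
  by move=> h1 h2; field; rewrite !fact_neq0 h1 h2 !natS_neq0.
rewrite telescope_sumr // {2}/G oppr0 !mul0r subr0 /G subnn -natr1.
by apply/eqP; ring.
Qed.

(** Coefficientwise form of [(1 - z)^(a + b - c) 2F1(a, b; c; z) = 2F1(c - a, c - b; c; z)],
    equivalent to the Pfaff-Saalschuetz sum. *)
Lemma Euler_transform a b c m : 0 < c ->
  conv (binr (c - a - b)) (F21 a b c) m = F21 (c - a) (c - b) c m.
Proof.
move=> c0; elim: m => [|m IH].
  rewrite /conv big_ord_recr big_ord0 /= add0r /binr /F21 !poch0 fact0.
  by field.
have ck : c + m%:R != 0 by rewrite gt_eqF // ltr_wpDr // ler0n.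
have m1 : m.+1%:R != 0 :> R by rewrite pnatr_eq0.
apply: (mulfI (mulf_neq0 m1 ck)).
rewrite Euler_transform_recurrence // IH /F21 !pochS factSr.
have := poch_neq0 m c0.
by move=> h; field; rewrite h ck fact_neq0 natS_neq0.
Qed.

Lemma binr_conv a b m : conv (binr a) (binr b) m = binr (a + b) m.
Proof.
elim: m => [|m IH].
  by rewrite /conv big_ord_recr big_ord0 /= add0r /binr !poch0 fact0; field.
have m1 : m.+1%:R != 0 :> R by rewrite pnatr_eq0.
apply: (mulfI m1).
have -> : m.+1%:R * binr (a + b) m.+1 = (a + b + m%:R) * binr (a + b) m.
  by rewrite /binr pochS factSr; field; rewrite fact_neq0 natS_neq0.
have E x k : k.+1%:R * binr x k.+1 = (x + k%:R) * binr x k.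
  by rewrite /binr pochS factSr; field; rewrite fact_neq0 natS_neq0.
(* The factor [m + 1 = (m + 1 - k) + k] is split as in the product rule; [E] then lowers one index
   in each half. *)
transitivity (\sum_(k < m.+2)
    (((m.+1 - k)%:R * binr a (m.+1 - k)) * binr b k
     + binr a (m.+1 - k) * (k%:R * binr b k))).
  rewrite /conv mulr_sumr; apply: eq_bigr => k _.
  have -> : m.+1%:R = (m.+1 - k)%:R + k%:R :> R.
    by rewrite -natrD subnK // -ltnS.
  by ring.
rewrite big_split /= big_ord_recr /= subnn !mul0r addr0.
rewrite [X in _ + X]big_ord_recl /= mul0r mulr0 add0r -big_split /=.
rewrite -IH /conv mulr_sumr; apply: eq_bigr => k _.
have km : (k <= m)%N by rewrite -ltnS.
rewrite /bump add1n subSS subSn // !E.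
have -> : m%:R = (m - k)%:R + k%:R :> R by rewrite -natrD subnK.
by ring.
Qed.

(** The left side is the terminating series [2F1(-m, b; c; 1)] divided by [m!]. *)
Lemma Chu_Vandermonde b c m : 0 < c ->
  \sum_(k < m.+1) (-1) ^+ k * poch b k / (k`!%:R * (m - k)`!%:R * poch c k) =
  poch (c - b) m / (m`!%:R * poch c m).
Proof.
move=> c0; elim: m => [|m IH].
  by rewrite big_ord_recr big_ord0 /= add0r !poch0 fact0 expr0; field.
have ck k : c + k%:R != 0 by rewrite gt_eqF // ltr_wpDr // ler0n.
have m1 : m.+1%:R != 0 :> R by rewrite pnatr_eq0.
apply: (mulfI (mulf_neq0 m1 (ck m))).
have -> : m.+1%:R * (c + m%:R) * (poch (c - b) m.+1 / (m.+1`!%:R * poch c m.+1))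
    = (c - b + m%:R) * (poch (c - b) m / (m`!%:R * poch c m)).
  rewrite !pochS factSr; have := poch_neq0 m c0.
  by move=> h; field; rewrite h ck fact_neq0 natS_neq0.
rewrite -IH.
(* A telescoping certificate of the same shape as for Euler's transformation. *)
pose G k : R := - k%:R * (c + k%:R - 1) *
  ((-1) ^+ k * poch b k / (k`!%:R * (m.+1 - k)`!%:R * poch c k)).
apply/eqP; rewrite -subr_eq0 {1}big_ord_recr /= subnn mulrDr addrAC.
rewrite !mulr_sumr -sumrB.
have -> : \sum_(k < m.+1)
   (m.+1%:R * (c + m%:R) *
      ((-1) ^+ k * poch b k / (k`!%:R * (m.+1 - k)`!%:R * poch c k)) -
    (c - b + m%:R) *
      ((-1) ^+ k * poch b k / (k`!%:R * (m - k)`!%:R * poch c k))) =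
  \sum_(0 <= k < m.+1) (G k.+1 - G k).
  rewrite big_mkord; apply: eq_bigr => k _.
  have km : (k <= m)%N by rewrite -ltnS.
  rewrite /G subSS subSn // !pochS !factSr exprS.
  have -> : m%:R = k%:R + (m - k)%:R :> R by rewrite -natrD subnKC.
  have -> : m.+1%:R = k%:R + (m - k)%:R + 1 :> R.
    by rewrite -natr1 -natrD subnKC.
  move: (m - k)%N => i; have := ck k; have := poch_neq0 k c0.
  by move=> h1 h2; field; rewrite !fact_neq0 h1 h2 !natS_neq0.
rewrite telescope_sumr // {2}/G oppr0 !mul0r subr0 /G subnn -natr1.
by apply/eqP; ring.
Qed.

(** The sum left when [opE] of [t^(m+1)] is integrated against [(1 - t)^(n+1)], with
    [s = alpha + beta + 4]; see [formE_XnUn]. *)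
Definition rho (s : R) m n : R :=
  \sum_(k < m.+1) poch (1 - s) (m - k) * poch s k
     / ((m - k)`!%:R * k`!%:R * poch (s + 1 + k%:R) n.+1) / m.+1`!%:R.

(* Euler's transformation brings the sum to a form symmetric in m and n. *)
Lemma rho_sym s m n : 0 < s -> rho s m n = rho s n m.
Proof.
move=> s0.
(* The summand symmetric in [i] and [j]; it arises with [N = j + 1 + k], where [k] is the index of
   the transformed sum. *)
pose f i j N : R := if (i < N)%N && (j < N)%N then
  (-1) ^+ (i + j + 1 - N) * (N.-1)`!%:R * N`!%:R
  / ((i + j + 1 - N)`!%:R * (N - i.+1)`!%:R * (N - j.+1)`!%:R
     * j.+1`!%:R * i.+1`!%:R * poch (s + 1) N) else 0.
have s1 k : 0 < s + 1 + k%:R.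
  by rewrite ltr_wpDr ?ler0n // addr_gt0.
suff E i j : rho s i j = \sum_(N < i + j + 2) f i j N.
  rewrite !E [(n + m)%N]addnC; apply: eq_bigr => N _.
  rewrite /f andbC [(n + m)%N]addnC; case: ifP => // _.
  by congr (_ / _); ring.
have -> : rho s i j = conv (binr (1 - s)) (F21 s (s + 1) (s + 1 + j.+1%:R)) i
     / poch (s + 1) j.+1 / i.+1`!%:R.
  rewrite /rho /conv -mulr_suml; congr (_ / _).
  rewrite mulr_suml; apply: eq_bigr => k _.
  have H : poch (s + 1) k * poch (s + 1 + k%:R) j.+1 =
           poch (s + 1) j.+1 * poch (s + 1 + j.+1%:R) k.
    by rewrite -!pochD addnC.
  have -> : poch (s + 1 + k%:R) j.+1 =
      poch (s + 1) j.+1 * poch (s + 1 + j.+1%:R) k / poch (s + 1) k.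
    by rewrite -H mulrAC divff ?mul1r // poch_neq0 // addr_gt0.
  rewrite /binr /F21.
  have h1 := poch_neq0 k (s1 j.+1).
  have h2 := poch_neq0 j.+1 (addr_gt0 s0 ltr01).
  have h3 := poch_neq0 k (addr_gt0 s0 ltr01).
  by field; rewrite !fact_neq0 h1 h2 h3.
(* [(1 - z)^(s - 1)] is split into [(1 - z)^(s - j - 1)], which has the exponent of Euler's
   transformation, and the polynomial [(1 - z)^j]. *)
have -> : conv (binr (1 - s)) (F21 s (s + 1) (s + 1 + j.+1%:R)) i =
   conv (binr (- j%:R)) (F21 (j.+1%:R + 1) j.+1%:R (s + 1 + j.+1%:R)) i.
  transitivity (conv (conv (binr (- j%:R)) (binr (j.+1%:R - s)))
                (F21 s (s + 1) (s + 1 + j.+1%:R)) i).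
    apply: eq_conv => // k _; rewrite binr_conv; congr binr; rewrite -natr1.
    by ring.
  rewrite -convA; apply: eq_conv => // k _.
  have -> : j.+1%:R - s = s + 1 + j.+1%:R - s - (s + 1) by ring.
  by rewrite Euler_transform //; congr F21; ring.
have -> : (i + j + 2 = j.+1 + i.+1)%N by lia.
(* The terms with [N <= j] are zero by the case distinction in [f], so the sum starts effectively at
   [N = j + 1]. *)
rewrite big_split_ord /= big1 ?add0r => [|k _]; last first.
  by rewrite /f [(j < _)%N]ltnNge -[(_ <= j)%N]ltnS ltn_ord andbF.
rewrite /conv !mulr_suml; apply: eq_bigr => k _.
have ki : (k <= i)%N by rewrite -ltnS.
rewrite /f /binr pochN_fact.
have -> : (j < j.+1 + k)%N by lia.
have -> : (i < j.+1 + k)%N = (i - k <= j)%N by lia.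
rewrite andbT; case: ifP => [ikj|]; last by rewrite !mul0r.
have -> : (i + j + 1 - (j.+1 + k) = i - k)%N by lia.
have -> : (j.+1 + k - i.+1 = j - (i - k))%N by lia.
have -> : (j.+1 + k - j.+1 = k)%N by lia.
rewrite /F21 pochD !natr1 !poch_fact addSn /=.
have h1 := poch_neq0 k (s1 j.+1).
have h2 := poch_neq0 j.+1 (addr_gt0 s0 ltr01).
by field; rewrite !fact_neq0 h1 h2.
Qed.

End Pochhammer.

(** * The Jacobi operator and the Jacobi weight *)

Section LinearExtension.
Variables (R : realType) (V : lmodType R) (e : nat -> V).

Definition extend (f : {poly R}) : V := \sum_(i < size f) f`_i *: e i.

Lemma extend_widen n (f : {poly R}) : (size f <= n)%N -> extend f = \sum_(i < n) f`_i *: e i.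
Proof.
move=> fn; rewrite /extend (big_ord_widen _ (fun i => f`_i *: e i) fn).
rewrite [RHS](bigID (fun i : 'I_n => (i < size f)%N)) /= [X in _ + X]big1 ?addr0 //.
by move=> i; rewrite -leqNgt => /(nth_default 0) ->; rewrite scale0r.
Qed.

Lemma extend_is_linear : linear extend.
Proof.
move=> a u v; pose n := maxn (size u) (size v).
have uvn : (size (a *: u + v)%R <= n)%N.
  apply: leq_trans (size_polyD _ _) _; rewrite geq_max leq_maxr andbT.
  by apply: leq_trans (size_scale_leq _ _) _; rewrite leq_maxl.
rewrite (extend_widen uvn) (extend_widen (leq_maxl _ _ : size u <= n)%N).
rewrite (extend_widen (leq_maxr _ _ : size v <= n)%N).
rewrite scaler_sumr -big_split /=; apply: eq_bigr => i _.
by rewrite coefD coefZ scalerDl scalerA.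
Qed.

HB.instance Definition _ := GRing.isLinear.Build R {poly R} V _ extend
  extend_is_linear.

Lemma extendXn n : extend 'X^n = e n.
Proof.
rewrite /extend size_polyXn big_ord_recr big1 /= ?add0r.
  by rewrite coefXn eqxx scale1r.
by move=> i _; rewrite coefXn ltn_eqF ?scale0r.
Qed.

End LinearExtension.

(** * The reflection [t -> 1 - t] *)

Section Mirror.
Variable R : realType.
Implicit Types (f g : {poly R}).

Lemma poly_lin_ind (P : {poly R} -> Prop) :
  (forall n, P 'X^n) -> (forall f g, P f -> P g -> P (f + g)) ->
  (forall c f, P f -> P (c *: f)) -> forall f, P f.
Proof.
move=> PX PD PZ f; rewrite -[f]coefK poly_def; apply: big_ind => //.
- by rewrite -[0](scale0r 'X^0); apply: PZ.
- by move=> i _; apply: PZ.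
Qed.

Definition mir f : {poly R} := f \Po (1 - 'X).

Lemma mir_is_linear : linear mir.
Proof. by move=> a u v; rewrite /mir linearP. Qed.

HB.instance Definition _ := GRing.isLinear.Build R {poly R} {poly R} _ mir
  mir_is_linear.

Lemma mirM f g : mir (f * g) = mir f * mir g.
Proof. exact: comp_polyM. Qed.

Lemma mirC c : mir c%:P = c%:P.
Proof. exact: comp_polyC. Qed.

Lemma mir1 : mir 1 = 1.
Proof. exact: mirC. Qed.

Lemma mirX : mir 'X = 1 - 'X.
Proof. exact: comp_polyX. Qed.

Lemma mirXn n : mir 'X^n = (1 - 'X) ^+ n.
Proof. by rewrite /mir rmorphXn /= comp_polyX. Qed.

Lemma mirK : involutive mir.
Proof.
move=> f; rewrite /mir -comp_polyA rmorphB /= comp_polyC comp_polyX.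
by rewrite opprB addrCA subrr addr0 comp_polyXr.
Qed.

Lemma horner_mir f x : (mir f).[x] = f.[1 - x].
Proof. by rewrite horner_comp !hornerE. Qed.

Lemma deriv_mir f : (mir f)^`() = - mir f^`().
Proof. by rewrite /mir deriv_comp derivB derivC derivX sub0r mulrN1. Qed.

Lemma size_mir f : size (mir f) = size f.
Proof.
rewrite size_comp_poly2 // -opprB size_polyN.
by rewrite -[1]/(1%:P) size_XsubC.
Qed.

Lemma poly_lin_ind_mir (P : {poly R} -> Prop) :
  (forall n, P ((1 - 'X) ^+ n)) -> (forall f g, P f -> P g -> P (f + g)) ->
  (forall c f, P f -> P (c *: f)) -> forall f, P f.
Proof.
move=> PX PD PZ f; rewrite -[f]mirK; move: (mir f).
apply: poly_lin_ind => [n|p q Pp Pq|c p Pp].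
- by rewrite mirXn.
- by rewrite linearD; apply: PD.
- by rewrite linearZ; apply: PZ.
Qed.

End Mirror.

(** * Integration against the Jacobi weight *)

Section Functional.
Variable R : realType.
Implicit Types (a b c x : R) (f g h : {poly R}) (n k : nat).

(* Integration against the normalized weight [t^b (1 - t)^a] on [0, 1], given
   by its moments. *)
Definition integ a b f : R :=
  extend (V := R^o) (fun n => poch (b + 1) n / poch (a + b + 2) n) f.

Lemma integD a b f g : integ a b (f + g) = integ a b f + integ a b g.
Proof. by rewrite /integ linearD. Qed.

Lemma integZ a b c f : integ a b (c *: f) = c * integ a b f.
Proof. by rewrite /integ linearZ. Qed.

Lemma integN a b f : integ a b (- f) = - integ a b f.
Proof. by rewrite /integ linearN. Qed.

Lemma integB a b f g : integ a b (f - g) = integ a b f - integ a b g.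
Proof. by rewrite integD integN. Qed.

Lemma integ0 a b : integ a b 0 = 0.
Proof. by rewrite /integ linear0. Qed.

Lemma integCM a b c f : integ a b (c%:P * f) = c * integ a b f.
Proof. by rewrite mul_polyC integZ. Qed.

Lemma integ_sum a b (I : Type) (r : seq I) (P : pred I) (F : I -> {poly R}) :
  integ a b (\sum_(i <- r | P i) F i) = \sum_(i <- r | P i) integ a b (F i).
Proof. by rewrite /integ linear_sum. Qed.

Lemma integXn a b n : integ a b 'X^n = poch (b + 1) n / poch (a + b + 2) n.
Proof. by rewrite /integ extendXn. Qed.

Variables (a b : R).
Hypotheses (a1 : -1 < a) (b1 : -1 < b).

Lemma param_gt0 : 0 < a + b + 2.
Proof. by move: a1 b1; lra. Qed.

Lemma parama_gt0 : 0 < a + 1.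
Proof. by move: a1; lra. Qed.

Lemma paramb_gt0 : 0 < b + 1.
Proof. by move: b1; lra. Qed.

Let p0 := param_gt0.

(** The Beta integral; [(1 - t)^(n+1) = (1 - t)^n - t (1 - t)^n] reduces it to the moments. *)
Lemma integ_XnUn m n :
  integ a b ('X^m * (1 - 'X) ^+ n) =
  poch (b + 1) m * poch (a + 1) n / poch (a + b + 2) (m + n).
Proof.
elim: n m => [|n IH] m; first by rewrite expr0 mulr1 integXn poch0 mulr1 addn0.
have -> : 'X^m * (1 - 'X) ^+ n.+1 =
  'X^m * (1 - 'X) ^+ n - 'X^(m.+1) * (1 - 'X) ^+ n :> {poly R} by rewrite !exprS; ring.
rewrite integB !IH addSn addnS !pochS.
have h := poch_neq0 (m + n) p0.
have h' : a + b + 2 + (m + n)%:R != 0 by rewrite gt_eqF // ltr_wpDr // ler0n.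
by move: h'; rewrite natrD => h'; field; rewrite h h'.
Qed.

Lemma integ1 : integ a b 1 = 1.
Proof. by rewrite -[1]/('X^0) integXn !poch0 divr1. Qed.

(** The integrand times the weight is the derivative of [t^(b+1) (1 - t)^(a+1) h]; on monomials this
    is the recurrence of the moments. *)
Lemma Pearson h :
  integ a b ('X * (1 - 'X) * h^`() + ((b + 1)%:P - (a + b + 2)%:P * 'X) * h) = 0.
Proof.
elim/poly_lin_ind: h => [n|f g Hf Hg|c f Hf].
- have h m := poch_neq0 m p0.
  have h' m : a + b + 2 + m%:R != 0 by rewrite gt_eqF // ltr_wpDr // ler0n.
  have -> : 'X * (1 - 'X) * ('X^n)^`() + ((b + 1)%:P - (a + b + 2)%:P * 'X) * 'X^n
     = (b + 1 + n%:R)%:P * 'X^n - (a + b + 2 + n%:R)%:P * 'X^(n.+1) :> {poly R}.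
    rewrite derivXn; case: n => [|n].
      by rewrite mulr0n mulr0 add0r !addr0 expr0 expr1; ring.
    by rewrite /= -mulr_natr -polyC_natr !exprS !polyCD; ring.
  rewrite integB !integCM !integXn !pochS.
  by field; rewrite h h'.
- by rewrite derivD [X in X + _]mulrDr [X in _ + X]mulrDr addrACA integD Hf Hg addr0.
- by rewrite derivZ -!scalerAr -scalerDr integZ Hf mulr0.
Qed.

End Functional.

(** * The Jacobi operator and its eigenvalues *)

Section JacobiOperator.
Variable R : realType.
Implicit Types (a b c x : R) (f g h : {poly R}) (n k : nat).

(** The operator [(1 - x^2) D^2 + (b - a - (a + b + 2) x) D], written in the variable [t]. *)
Definition jacL a b f : {poly R} :=
  'X * (1 - 'X) * f^`()^`() + ((b + 1)%:P - (a + b + 2)%:P * 'X) * f^`().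

Lemma jacL_is_linear a b : linear (jacL a b).
Proof. by move=> c u v; rewrite /jacL !linearP /= -!mul_polyC; ring. Qed.

HB.instance Definition _ a b := GRing.isLinear.Build R {poly R} {poly R} _
  (jacL a b) (jacL_is_linear a b).

Lemma jacL_mir a b f : jacL a b (mir f) = mir (jacL b a f).
Proof.
rewrite /jacL deriv_mir derivN deriv_mir opprK linearD /= !mirM linearB /=.
rewrite linearB /= !mirM mir1 !mirC mirX !polyCD.
by ring.
Qed.

Lemma coef_jacL a b f k :
  (jacL a b f)`_k = k.+1%:R * (k.+1%:R + b) * f`_k.+1
                    - k%:R * (k%:R + a + b + 1) * f`_k.
Proof.
have -> : jacL a b f = f^`()^`() * 'X - f^`()^`() * 'X * 'X
   + (b + 1) *: f^`() - (a + b + 2) *: (f^`() * 'X).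
  by rewrite /jacL -!mul_polyC; ring.
rewrite !coefD !coefN !coefZ !coefMX !coef_deriv.
case: k => [|[|k]] /=; rewrite ?mulr0n; ring.
Qed.

(** Integration by parts, that is [Pearson] for the product of [f'] and [g]. *)
Lemma integ_jacL a b f g : -1 < a -> -1 < b ->
  integ a b (jacL a b f * g) = - integ a b ('X * (1 - 'X) * f^`() * g^`()).
Proof.
move=> a1 b1; have := Pearson a1 b1 (f^`() * g); rewrite derivM.
have -> : 'X * (1 - 'X) * (f^`()^`() * g + f^`() * g^`()) +
   ((b + 1)%:P - (a + b + 2)%:P * 'X) * (f^`() * g) =
   jacL a b f * g + 'X * (1 - 'X) * f^`() * g^`() by rewrite /jacL; ring.
by rewrite integD => /eqP; rewrite addr_eq0 => /eqP.
Qed.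

Lemma jacL_sym a b f g : -1 < a -> -1 < b ->
  integ a b (jacL a b f * g) = integ a b (jacL a b g * f).
Proof.
by move=> a1 b1; rewrite !integ_jacL //; congr (- integ _ _ _); ring.
Qed.

Lemma integ_mir a b f : -1 < a -> -1 < b -> integ a b (mir f) = integ b a f.
Proof.
move=> a1 b1; elim/poly_lin_ind: f => [n|f g Hf Hg|c f Hf].
- rewrite mirXn -[X in integ a b X]mul1r -[1]/('X^0) integ_XnUn // integXn.
  by rewrite poch0 mul1r add0n [b + a]addrC.
- by rewrite linearD !integD Hf Hg.
- by rewrite linearZ !integZ Hf.
Qed.

Lemma integ_mirr a b f : -1 < a -> -1 < b -> integ a b f = integ b a (mir f).
Proof. by move=> a1 b1; rewrite -integ_mir // mirK. Qed.

Definition jlam a b n : R := n%:R * (n%:R + a + b + 1).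

Lemma jlam_neq a b k n : -1 < a -> -1 < b -> (k < n)%N -> jlam a b k != jlam a b n.
Proof.
move=> a1 b1 kn; rewrite -subr_eq0.
have -> : jlam a b k - jlam a b n = (k%:R - n%:R) * (k%:R + n%:R + a + b + 1).
  by rewrite /jlam; ring.
have n1 : 1 <= n%:R :> R by rewrite ler1n (leq_ltn_trans _ kn).
have k0 : 0 <= k%:R :> R by rewrite ler0n.
rewrite mulf_neq0 ?subr_eq0 ?eqr_nat ?ltn_eqF // gt_eqF //.
by move: a1 b1 n1 k0; lra.
Qed.

Lemma jlam_gt0 a b n : -1 < a -> -1 < b -> (0 < n)%N -> 0 < jlam a b n.
Proof.
move=> a1 b1 n0; have n1 : 1 <= n%:R :> R by rewrite ler1n.
by rewrite /jlam mulr_gt0 ?ltr0n //; move: a1 b1 n1; lra.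
Qed.

(** By its leading coefficient, an eigenvector of degree [k] has eigenvalue [- jlam a b k], and
    these are distinct. *)
Lemma jacL_eigen_low a b n f : -1 < a -> -1 < b ->
  (size f <= n)%N -> jacL a b f = - jlam a b n *: f -> f = 0.
Proof.
move=> a1 b1 fn Lf; apply/eqP; case: (altP (f =P 0)) => // f0.
pose k := (size f).-1; have sf : size f = k.+1 by rewrite prednK // size_poly_gt0.
have : (jacL a b f)`_k = (- jlam a b n *: f)`_k by rewrite Lf.
rewrite coef_jacL coefZ (@nth_default _ 0 f k.+1) ?sf // mulr0 sub0r mulNr.
move/oppr_inj/mulIf => E.
have fk : f`_k != 0 by rewrite -lead_coefE lead_coef_eq0.
have := @jlam_neq a b k n a1 b1; rewrite -sf fn => /(_ isT).
by rewrite -E ?eqxx // /jlam mulrA.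
Qed.

End JacobiOperator.

(** * Orthogonality *)

Section LowDegree.
Variable R : realType.
Implicit Types (f g p : {poly R}) (n k : nat).

Lemma size_leq_coef0 n f : (size f <= n.+1)%N -> f`_n = 0 -> (size f <= n)%N.
Proof.
move=> fn f0; apply/leq_sizeP => j; rewrite leq_eqVlt => /predU1P[<-//|nj].
by rewrite nth_default // (leq_trans fn).
Qed.

Lemma size_cancel_lead n p f : size p = n.+1 -> (size f <= n.+1)%N ->
  (size (f - (f`_n / p`_n) *: p)%R <= n)%N.
Proof.
move=> sp sf; apply: size_leq_coef0.
  apply: leq_trans (size_polyD _ _) _; rewrite geq_max sf size_polyN.
  by apply: leq_trans (size_scale_leq _ _) _; rewrite sp.
have pn : p`_n != 0 by rewrite -[n]/(n.+1.-1) -sp -lead_coefE lead_coef_eq0 -size_poly_eq0 sp.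
by rewrite coefB coefZ divfK // subrr.
Qed.

Lemma coef_mir_lead n f : (size f <= n.+1)%N -> (mir f)`_n = (-1) ^+ n * f`_n.
Proof.
move=> fn; have s2 : size (1 - 'X : {poly R}) = 2.
  by rewrite -opprB size_polyN -[1]/(1%:P) size_XsubC.
have := fn; rewrite leq_eqVlt => /predU1P[sf|sf]; last first.
  by rewrite !nth_default ?mulr0 ?size_mir.
have := @lead_coef_comp _ f (1 - 'X); rewrite s2 => /(_ isT).
rewrite !lead_coefE -/(mir f) size_mir sf s2 /= => ->.
by rewrite coefB coef1 coefX sub0r mulrC.
Qed.

(** At index 0 the coefficient is a division by [0], whose value is [0]; this fixes the constant of
    integration. *)
Definition primitive f : {poly R} := \poly_(i < (size f).+1) (f`_i.-1 / i%:R).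

Lemma deriv_primitive f : (primitive f)^`() = f.
Proof.
apply/polyP => i; rewrite coef_deriv coef_poly ltnS /=.
case: ltnP => fi; last by rewrite mul0rn nth_default.
by rewrite -(mulr_natr (_ / _)) divfK // pnatr_eq0.
Qed.

Lemma size_primitive f : (size (primitive f) <= (size f).+1)%N.
Proof. exact: size_poly. Qed.

Lemma deriv_sum_ord n (F : 'I_n -> {poly R}) :
  (\sum_(i < n) F i)^`() = \sum_(i < n) (F i)^`().
Proof. exact: raddf_sum. Qed.

End LowDegree.

(** * Classical Jacobi polynomials and positivity of the weight *)

Section ClassicalJacobi.
Variable R : realType.
Implicit Types (a b c x : R) (f g h : {poly R}) (n k : nat).

(** The sign turns powers of [(x - 1) / 2] into powers of [u = (1 - x) / 2]. *)
Definition jcoef a b n k : R :=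
  (-1) ^+ k * (poch (n%:R + a + b + 1) k / k`!%:R)
  * (poch (a + k%:R + 1) (n - k) / (n - k)`!%:R).

Definition ujac a b n : {poly R} := \poly_(k < n.+1) jcoef a b n k.

(* Here and for [tQ], [tR], [tS], [tY] below, the prefix [t] means the variable
   [t = (x + 1) / 2]; [ujac] uses [u = 1 - t]. *)
Definition tjac a b n : {poly R} := mir (ujac a b n).

Definition tvar : {poly R} := 2^-1 *: ('X + 1).

Lemma tvar_compl : 1 - tvar = - (2^-1 *: ('X - 1)).
Proof.
rewrite /tvar -!mul_polyC.
have E : (2^-1 : R)%:P * 2 = 1 by rewrite -polyC_natr -polyCM mulVf // pnatr_eq0.
by rewrite -[X in X - _]E; ring.
Qed.

Lemma jacobi_tvar a b n : jacobi a b n = tjac a b n \Po tvar.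
Proof.
rewrite /tjac /mir -comp_polyA rmorphB /= rmorph1 comp_polyX.
rewrite tvar_compl.
rewrite /ujac poly_def raddf_sum /=; apply: eq_bigr => k _.
rewrite comp_polyZ rmorphXn /= comp_polyX -(scaleN1r (2^-1 *: ('X - 1))) (exprZn (-1)) scalerA.
by congr (_ *: _); rewrite /jcoef [RHS]mulrC !mulrA -expr2 sqrr_sign mul1r.
Qed.

Lemma coef_ujac a b n k : (ujac a b n)`_k = if (k <= n)%N then jcoef a b n k else 0.
Proof. by rewrite coef_poly ltnS. Qed.

Lemma jlamC a b n : jlam a b n = jlam b a n.
Proof. by rewrite /jlam; ring. Qed.

Lemma jcoef_rec a b n k : (k < n)%N ->
  k.+1%:R * (k.+1%:R + a) * jcoef a b n k.+1 =
  - ((n%:R - k%:R) * (n%:R + k%:R + a + b + 1) * jcoef a b n k).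
Proof.
move=> kn; have E : (n - k = (n - k.+1).+1)%N by rewrite -subSn.
rewrite /jcoef E exprS.
rewrite [poch (a + k%:R + 1) _]pochSl pochS !factSr.
have -> : n%:R = k%:R + (n - k.+1).+1%:R :> R.
  by rewrite -natrD -subSn // subSS subnKC // ltnW.
have -> : a + k.+1%:R + 1 = a + k%:R + 1 + 1 by rewrite -natr1; ring.
by field; rewrite !fact_neq0 !natS_neq0.
Qed.

Lemma jacL_ujac a b n : jacL b a (ujac a b n) = - jlam a b n *: ujac a b n.
Proof.
apply/polyP => k; rewrite coef_jacL coefZ !coef_ujac.
case: (ltngtP k n) => [kn|kn|->].
- by rewrite jcoef_rec // /jlam; ring.
- by rewrite !mulr0 subrr.
- by rewrite mulr0 sub0r /jlam; ring.
Qed.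

Lemma jacL_tjac a b n : jacL a b (tjac a b n) = - jlam a b n *: tjac a b n.
Proof. by rewrite /tjac jacL_mir jacL_ujac linearZ. Qed.

Lemma jlead_gt0 a b n : -1 < a -> -1 < b -> 0 < poch (n%:R + a + b + 1) n / n`!%:R.
Proof.
move=> a1 b1; rewrite divr_gt0 ?ltr0n ?fact_gt0 //.
case: n => [|n]; first by rewrite poch0.
have n1 : 1 <= n.+1%:R :> R by rewrite ler1n.
by apply: poch_gt0; move: a1 b1 n1; lra.
Qed.

Lemma lead_ujac a b n : (ujac a b n)`_n = (-1) ^+ n * (poch (n%:R + a + b + 1) n / n`!%:R).
Proof. by rewrite coef_ujac leqnn /jcoef subnn poch0 fact0 divr1 mulr1. Qed.

Lemma size_ujac a b n : -1 < a -> -1 < b -> size (ujac a b n) = n.+1.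
Proof.
move=> a1 b1; rewrite size_poly_eq // -[X in X != 0]/(jcoef a b n n).
have := lead_ujac a b n; rewrite coef_ujac leqnn => ->.
by rewrite mulf_neq0 ?signr_eq0 // gt_eqF // jlead_gt0.
Qed.

Lemma size_tjac a b n : -1 < a -> -1 < b -> size (tjac a b n) = n.+1.
Proof. by move=> a1 b1; rewrite size_mir size_ujac. Qed.

Lemma tjac_neq0 a b n : -1 < a -> -1 < b -> tjac a b n != 0.
Proof. by move=> a1 b1; rewrite -size_poly_eq0 size_tjac. Qed.

Lemma coef_tjac_neq0 a b n : -1 < a -> -1 < b -> (tjac a b n)`_n != 0.
Proof.
move=> a1 b1; have := tjac_neq0 n a1 b1.
by rewrite -lead_coef_eq0 lead_coefE size_tjac.
Qed.

(** Both sides are eigenvectors of [jacL b a] with the same eigenvalue and the same leading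
    coefficient, so their difference is an eigenvector of too low a degree. *)
Lemma ujac_tjac a b n : -1 < a -> -1 < b -> ujac a b n = (-1) ^+ n *: tjac b a n.
Proof.
move=> a1 b1; apply/eqP; rewrite -subr_eq0; apply/eqP.
apply: (@jacL_eigen_low _ b a n) => //; last first.
  rewrite linearB linearZ /= jacL_ujac jacL_tjac jlamC scalerBr !scalerA.
  by rewrite mulrC.
apply: size_leq_coef0.
  apply: leq_trans (size_polyD _ _) _; rewrite geq_max size_ujac // size_polyN leqnn.
  by apply: leq_trans (size_scale_leq _ _) _; rewrite size_tjac.
rewrite coefB coefZ coef_mir_lead ?size_ujac // !lead_ujac.
by rewrite signrMK [n%:R + b + a]addrAC subrr.
Qed.

Lemma mir_tjac a b n : -1 < a -> -1 < b -> mir (tjac a b n) = (-1) ^+ n *: tjac b a n.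
Proof. by move=> a1 b1; rewrite mirK ujac_tjac. Qed.

Lemma tjac_at1 a b n : (tjac a b n).[1] = poch (a + 1) n / n`!%:R.
Proof.
rewrite horner_mir subrr horner_coef0 coef_ujac /= /jcoef poch0 subn0 addr0.
by rewrite fact0 divr1 !mul1r.
Qed.

Lemma tjac_at0 a b n : -1 < a -> -1 < b ->
  (tjac a b n).[0] = (-1) ^+ n * (poch (b + 1) n / n`!%:R).
Proof.
by move=> a1 b1; rewrite horner_mir subr0 ujac_tjac // hornerZ tjac_at1.
Qed.

(** Induction on the degree of [g], removing its leading multiple of [tjac a b k]; symmetry of
    [jacL] and distinct eigenvalues make the product of [tjac a b n] and [tjac a b k] integrate to
    zero. *)
Lemma integ_tjac_orth a b n g : -1 < a -> -1 < b -> (size g <= n)%N ->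
  integ a b (tjac a b n * g) = 0.
Proof.
move=> a1 b1; have: (n <= n)%N by [].
elim: {1 3}n g => [|k IH] g kn sg.
  by move: sg; rewrite leqn0 size_poly_eq0 => /eqP ->; rewrite mulr0 integ0.
have E := size_cancel_lead (size_tjac k a1 b1) sg.
set c := _ / _ in E; rewrite -[g](subrK (c *: tjac a b k)) mulrDr integD.
rewrite IH ?(ltnW kn) // add0r -scalerAr integZ.
have := jacL_sym (tjac a b n) (tjac a b k) a1 b1.
rewrite !jacL_tjac -!scalerAl !integZ [tjac a b k * _]mulrC => H.
suff -> : integ a b (tjac a b n * tjac a b k) = 0 by rewrite mulr0.
apply/eqP; move/eqP: H; rewrite -subr_eq0 -mulrBl mulf_eq0 => /orP[|//].
by rewrite opprK addrC subr_eq0 (negPf (jlam_neq a1 b1 kn)).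
Qed.

(** Multiplication by [t (1 - t)] raises both exponents of the weight by one; the factor is the
    quotient of the normalizing constants. *)
Lemma integ_shift a b f : -1 < a -> -1 < b ->
  integ a b ('X * (1 - 'X) * f) =
  (a + 1) * (b + 1) / ((a + b + 2) * (a + b + 3)) * integ (a + 1) (b + 1) f.
Proof.
move=> a1 b1; elim/poly_lin_ind: f => [n|f g Hf Hg|c f Hf].
- have -> : 'X * (1 - 'X) * 'X^n = 'X^(n.+1) * (1 - 'X) ^+ 1 :> {poly R}.
    by rewrite exprS expr1; ring.
  rewrite integ_XnUn // integXn poch1 addn1 !pochSl.
  have -> : a + 1 + (b + 1) + 2 = a + b + 2 + 1 + 1 by ring.
  have p2 : 0 < a + b + 2 by move: a1 b1; lra.
  have h1 : a + b + 2 != 0 by rewrite gt_eqF.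
  have -> : a + b + 3 = a + b + 2 + 1 by ring.
  have h2 : a + b + 2 + 1 != 0 by rewrite gt_eqF //; move: p2; lra.
  have h3 : poch (a + b + 2 + 1 + 1) n != 0 by apply: poch_neq0; move: p2; lra.
  move: (poch (a + b + 2 + 1 + 1) n) h3 => y h3.
  by field; rewrite h1 h2 h3.
- by rewrite [_ * (f + g)]mulrDr !integD Hf Hg -mulrDr.
- by rewrite -scalerAr !integZ Hf; ring.
Qed.

(** Since [integ] is defined by moments, positivity is proved by induction on the degree, for all
    parameters at once: integration by parts reduces the norm of a Jacobi polynomial to that of its
    derivative for the parameters [a + 1], [b + 1], and a general [f] is split orthogonally. *)
Lemma integ_pos a b f : -1 < a -> -1 < b -> f != 0 -> 0 < integ a b (f * f).
Proof.
move: {2}(size f) (leqnn (size f)) => n; elim: n f a b => [|n IH] f a b.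
  by rewrite leqn0 size_poly_eq0 => ->.
move=> sf a1 b1 f0.
have PP : 0 < integ a b (tjac a b n * tjac a b n).
  case: n IH {sf} => [|n] IH.
    have -> : tjac a b 0 = 1.
      rewrite /tjac (_ : ujac a b 0 = 1) ?mir1 //; apply/polyP => k.
      rewrite coef_ujac coef1 leqn0; case: eqP => // ->.
      by rewrite /jcoef !poch0 fact0 divr1 !mul1r.
    by rewrite mulr1 integ1.
  have := integ_jacL (tjac a b n.+1) (tjac a b n.+1) a1 b1.
  rewrite jacL_tjac -scalerAl integZ -mulrA integ_shift // mulNr => /oppr_inj E.
  rewrite -(pmulr_rgt0 _ (jlam_gt0 a1 b1 (ltn0Sn n))) E mulr_gt0 //.
    by rewrite divr_gt0 // mulr_gt0 //; move: a1 b1; lra.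
  have s' : (size (tjac a b n.+1)^`() <= n.+1)%N.
    by rewrite -ltnS -(size_tjac n.+1 a1 b1) lt_size_deriv // tjac_neq0.
  apply: IH => //; [by move: a1; lra|by move: b1; lra|].
  apply/eqP => /(congr1 (fun p : {poly R} => p`_n)); rewrite coef_deriv coef0.
  by move/eqP; rewrite mulrn_eq0 /= (negPf (coef_tjac_neq0 _ a1 b1)).
have E := size_cancel_lead (size_tjac n a1 b1) sf.
set c := _ / _ in E; set g := f - _ in E.
have -> : f = g + c *: tjac a b n by rewrite subrK.
have -> : integ a b ((g + c *: tjac a b n) * (g + c *: tjac a b n)) =
  integ a b (g * g) + c ^+ 2 * integ a b (tjac a b n * tjac a b n).
  have -> : (g + c *: tjac a b n) * (g + c *: tjac a b n) =
     g * g + (c ^+ 2) *: (tjac a b n * tjac a b n) + (c *+ 2) *: (tjac a b n * g).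
    by rewrite -!mul_polyC polyC_exp polyCMn; ring.
  by rewrite !integD !integZ [integ a b (tjac a b n * g)]integ_tjac_orth // mulr0 addr0.
have [c0|c0] := eqVneq c 0.
  rewrite c0 expr0n mul0r addr0; apply: IH => //.
  by rewrite /g c0 scale0r subr0.
apply: ltr_wpDl; last by apply: mulr_gt0; rewrite // exprn_even_gt0.
by have [->|g0] := eqVneq g 0; [rewrite mulr0 integ0|rewrite ltW // IH].
Qed.

End ClassicalJacobi.

(** * Koornwinder's polynomials and their orthogonality *)

Section Koornwinder.
Variable R : realType.
Implicit Types (a b c x M N : R) (f g h : {poly R}) (n k : nat).

Definition kQ a b n : R :=
  poch (b + 2) n.-1 * poch (a + b + 2) n.-1 / (poch (a + 1) n * n`!%:R).

Definition kS a b n : R :=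
  poch (a + b + 2) n * poch (a + b + 2) n.-1
  / ((a + 1) * (b + 1) * n`!%:R * (n.-1)`!%:R).

(** The plus sign is due to [(x - 1) d/dx = - (1 - t) d/dt]. *)
Definition tQ a b n : {poly R} := if n == 0%N then 0 else
  kQ a b n *: (jlam a b n *: tjac a b n
               + (b + 1) *: ((1 - 'X) * (tjac a b n)^`())).

Definition tR a b n : {poly R} := if n == 0%N then 0 else
  kQ b a n *: (jlam a b n *: tjac a b n - (a + 1) *: ('X * (tjac a b n)^`())).

Definition tS a b n : {poly R} := if n == 0%N then 0 else
  kS a b n *: (jlam a b n *: tjac a b n
               + (b + 1) *: ((1 - 'X) * (tjac a b n)^`())
               - (a + 1) *: ('X * (tjac a b n)^`())).

Definition tY a b M N n : {poly R} :=
  tjac a b n + M *: tQ a b n + N *: tR a b n + (M * N) *: tS a b n.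

Definition form a b M N f g : R :=
  integ a b (f * g) + M * (f.[0] * g.[0]) + N * (f.[1] * g.[1]).

Lemma hornerU x : (1 - 'X).[x] = 1 - x :> R.
Proof. by rewrite !hornerE. Qed.

Lemma deriv_tvar f : (f \Po tvar R)^`() = 2^-1 *: (f^`() \Po tvar R).
Proof.
rewrite deriv_comp; have -> : (tvar R)^`() = (2^-1)%:P.
  by rewrite /tvar derivZ derivD derivX derivC addr0 -mul_polyC mulr1.
by rewrite mulrC mul_polyC.
Qed.

Lemma gen_jacobi_tvar a b M N n :
  gen_jacobi a b M N n = tY a b M N n \Po tvar R.
Proof.
have EU : ('X - 1) * (2^-1 *: ((tjac a b n)^`() \Po tvar R)) =
    - (((1 - 'X) * (tjac a b n)^`()) \Po tvar R).
  by rewrite rmorphM rmorphB /= rmorph1 comp_polyX tvar_compl -!mul_polyC; ring.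
have EX : ('X + 1) * (2^-1 *: ((tjac a b n)^`() \Po tvar R)) =
    ('X * (tjac a b n)^`()) \Po tvar R.
  by rewrite rmorphM /= comp_polyX /tvar -!mul_polyC; ring.
rewrite /gen_jacobi /tY !comp_polyD !comp_polyZ -jacobi_tvar.
congr (_ + _ *: _ + _ *: _ + _ *: _).
- rewrite /jacobiQ /tQ; case: eqP => _; first by rewrite comp_poly0.
  rewrite comp_polyZ comp_polyD !comp_polyZ -jacobi_tvar [in RHS]/jlam; congr (_ *: (_ + _)).
  by rewrite {1}jacobi_tvar deriv_tvar EU scalerN opprK.
- rewrite /jacobiR /tR; case: eqP => _; first by rewrite comp_poly0.
  rewrite comp_polyZ comp_polyB !comp_polyZ -jacobi_tvar [in RHS]/jlam /kQ [b + a]addrC.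
  by congr (_ *: (_ - _ *: _)); rewrite {1}jacobi_tvar deriv_tvar EX.
- rewrite /jacobiS /tS; case: eqP => _; first by rewrite comp_poly0.
  rewrite comp_polyZ comp_polyB comp_polyD !comp_polyZ -jacobi_tvar [in RHS]/jlam.
  congr (_ *: _); rewrite {2}jacobi_tvar deriv_tvar mulrDl -!scalerAl EU EX.
  by rewrite scalerN opprD opprK addrA.
Qed.

Section SymmetryAtMinusOne.
Variables (a b : R).
Hypotheses (a1 : -1 < a) (b1 : -1 < b).

(** At [t = 0] the Jacobi equation reads [(b + 1) P_n'(0) = - jlam a b n P_n(0)]. *)
Lemma tQ_at0 n : (tQ a b n).[0] = 0.
Proof.
rewrite /tQ; case: eqP => _; first by rewrite horner0.
have := congr1 (horner^~ 0) (jacL_tjac a b n).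
rewrite /jacL hornerZ hornerD !hornerM hornerX !mul0r add0r hornerD hornerN hornerM.
rewrite hornerX mulr0 subr0 !hornerC => E.
by rewrite hornerZ hornerD !hornerZ hornerM hornerU subr0 mul1r E mulNr subrr mulr0.
Qed.

Lemma mir_dtjac n : mir (tjac a b n)^`() = - ((-1) ^+ n *: (tjac b a n)^`()).
Proof. by rewrite -derivZ -mir_tjac // (deriv_mir (tjac a b n)) opprK. Qed.

Lemma mir_tQ n : mir (tQ a b n) = (-1) ^+ n *: tR b a n.
Proof.
rewrite /tQ /tR; case: eqP => _; first by rewrite linear0 scaler0.
rewrite linearZ linearD !linearZ /= mirM linearB /= mir1 mirX mir_tjac //.
rewrite mir_dtjac //.
rewrite subKr jlamC -!mul_polyC; ring.
Qed.

End SymmetryAtMinusOne.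

Lemma mir_tR a b n : -1 < a -> -1 < b -> mir (tR a b n) = (-1) ^+ n *: tQ b a n.
Proof.
move=> a1 b1; rewrite -[tQ b a n]mirK mir_tQ // linearZ scalerA.
by rewrite -expr2 sqrr_sign scale1r.
Qed.

Lemma tR_at1 a b n : -1 < a -> -1 < b -> (tR a b n).[1] = 0.
Proof.
move=> a1 b1; rewrite -[tR a b n]mirK mir_tR // linearZ hornerZ horner_mir.
by rewrite subrr tQ_at0 mulr0.
Qed.

Lemma tQ_at1 a b n : (0 < n)%N -> (tQ a b n).[1] = kQ a b n * (jlam a b n * (tjac a b n).[1]).
Proof.
by case: n => // n _; rewrite /tQ /= hornerZ hornerD !hornerZ hornerM hornerU subrr mul0r mulr0 addr0.
Qed.

Lemma tR_at0 a b n : (0 < n)%N -> (tR a b n).[0] = kQ b a n * (jlam a b n * (tjac a b n).[0]).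
Proof.
by case: n => // n _; rewrite /tR /= hornerZ hornerD hornerN !hornerZ hornerM hornerX mul0r mulr0 subr0.
Qed.

Lemma kQ_gt0 a b n : -1 < a -> -1 < b -> 0 < kQ a b n.
Proof.
move=> a1 b1; rewrite divr_gt0 // mulr_gt0 ?ltr0n ?fact_gt0 //;
  by apply: poch_gt0; move: a1 b1; lra.
Qed.

(** The bracket of [tS] differs from that of [tQ] only by a multiple of [t]. *)
Lemma tS_at0 a b n : -1 < a -> -1 < b -> (tS a b n).[0] = 0.
Proof.
move=> a1 b1; rewrite /tS; case: eqP => [_|n0]; first by rewrite horner0.
have := tQ_at0 a b n; rewrite /tQ; case: eqP => // _.
move/eqP; rewrite !hornerZ mulf_eq0 gt_eqF ?kQ_gt0 //= => /eqP E.
by rewrite hornerD hornerN E hornerZ hornerM hornerX mul0r mulr0 subr0 mulr0.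
Qed.

Lemma tS_at1 a b n : -1 < a -> -1 < b -> (tS a b n).[1] = 0.
Proof.
move=> a1 b1; rewrite /tS; case: eqP => [_|n0]; first by rewrite horner0.
have := tR_at1 n a1 b1; rewrite /tR; case: eqP => // _.
move/eqP; rewrite !hornerZ mulf_eq0 gt_eqF ?kQ_gt0 //= => /eqP E.
by rewrite addrAC hornerD E hornerZ hornerM hornerU subrr mul0r mulr0 addr0 mulr0.
Qed.

Section Orthogonality.
Variables (a b : R).
Hypotheses (a1 : -1 < a) (b1 : -1 < b).

(** With [f = f(0) + t g] and [G] a primitive of [g], the part with [t g] is, up to sign, the
    integral of [jacL a b P_n] times [G], which vanishes because [G] has degree below [n]. *)
Lemma integ_UdP_const n f : (size f <= n)%N ->
  integ a b ((1 - 'X) * (tjac a b n)^`() * f)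
  = f.[0] * integ a b ((1 - 'X) * (tjac a b n)^`()).
Proof.
elim/poly_ind: f => [|g c _ sf]; first by rewrite mulr0 integ0 horner0 mul0r.
rewrite hornerMXaddC mulr0 add0r mulrDr integD [_ * c%:P]mulrC integCM.
have -> : (1 - 'X) * (tjac a b n)^`() * (g * 'X) =
    'X * (1 - 'X) * (tjac a b n)^`() * (primitive g)^`().
  by rewrite deriv_primitive; ring.
have : integ a b (jacL a b (tjac a b n) * primitive g) = 0.
  rewrite jacL_tjac -scalerAl integZ integ_tjac_orth ?mulr0 //.
  have [->|g0] := eqVneq g 0; last first.
    by apply: leq_trans (size_primitive g) _; move: sf; rewrite size_MXaddC (negPf g0).
  by rewrite (_ : primitive 0 = 0) ?size_poly0 //; apply/polyP => i;
     rewrite coef_poly !coef0 mul0r if_same.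
by rewrite integ_jacL // => /eqP; rewrite oppr_eq0 => /eqP ->; rewrite add0r.
Qed.

End Orthogonality.

Lemma integ_XdP a b n f : -1 < a -> -1 < b ->
  integ a b ('X * (tjac a b n)^`() * f) =
  - (-1) ^+ n * integ b a ((1 - 'X) * (tjac b a n)^`() * mir f).
Proof.
move=> a1 b1; rewrite integ_mirr // !mirM mirX mir_dtjac // -integZ.
by congr (integ _ _ _); rewrite scaleNr -!mul_polyC; ring.
Qed.

Lemma integ_XdP_const a b n f : -1 < a -> -1 < b -> (size f <= n)%N ->
  integ a b ('X * (tjac a b n)^`() * f) = f.[1] * integ a b ('X * (tjac a b n)^`()).
Proof.
move=> a1 b1 sf; rewrite integ_XdP // integ_UdP_const ?size_mir //.
rewrite -['X * _]mulr1 integ_XdP // mir1 mulr1 horner_mir subr0.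
by rewrite mulrCA.
Qed.

(** After a reflection the derivative is integrated term by term; the resulting Chu-Vandermonde sum
    evaluates to a multiple of [(-m)_m], which produces the sign. *)
Lemma integ_UdP_val a b m : -1 < a -> -1 < b ->
  integ a b ((1 - 'X) * (tjac a b m.+1)^`()) =
  (-1) ^+ m * poch (a + 1) m.+1 * (m.+1%:R + a + b + 1) / poch (a + b + 2) m.+1.
Proof.
move=> a1 b1; have p0 := param_gt0 a1 b1.
have p1 : 0 < a + b + 2 + 1 by move: p0; lra.
rewrite integ_mirr // mirM linearB /= mir1 mirX subKr.
rewrite /tjac deriv_mir linearN /= mirK mulrN integN.
rewrite /ujac poly_def deriv_sum_ord mulr_sumr integ_sum big_ord_recl.
rewrite derivZ expr0 derivC scaler0 mulr0 integ0 add0r.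
transitivity (poch (a + 1) m.+1 * (m.+1%:R + a + b + 1) / (a + b + 2) *
  \sum_(j < m.+1) (-1) ^+ j * poch (m.+1%:R + a + b + 2) j
     / (j`!%:R * (m - j)`!%:R * poch (a + b + 2 + 1) j)).
  rewrite mulr_sumr -sumrN; apply: eq_bigr => j _.
  have jm : (j <= m)%N by rewrite -ltnS.
  rewrite derivZ derivXn /= /bump add1n /= -scalerAr -scaler_nat -scalerAr -exprS.
  rewrite !integZ integXn /jcoef subSS exprS add0n.
  have -> : poch (a + 1) m.+1 = poch (a + 1) j.+1 * poch (a + j.+1%:R + 1) (m - j).
    by rewrite addrAC -pochD addSn subnKC.
  rewrite [poch (m.+1%:R + a + b + 1) _]pochSl [poch (b + a + 2) _]pochSl factSr.
  have -> : m.+1%:R + a + b + 1 + 1 = m.+1%:R + a + b + 2 by ring.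
  have h1 : a + b + 2 != 0 by rewrite gt_eqF.
  rewrite [b + a]addrC.
  have h2 := poch_neq0 j p1.
  by field; rewrite h1 h2 !fact_neq0 natS_neq0.
rewrite Chu_Vandermonde //.
have -> : a + b + 2 + 1 - (m.+1%:R + a + b + 2) = - m%:R by rewrite -natr1; ring.
rewrite pochN_fact leqnn subnn fact0 [poch (a + b + 2) _]pochSl.
have h1 : a + b + 2 != 0 by rewrite gt_eqF.
by field; rewrite h1 (poch_neq0 m p1) !fact_neq0.
Qed.

(** The prefactor [kQ] is the one for which the integral of [tQ] cancels the point mass of [tjac] at
    [t = 0]. *)
Lemma kQ_integ a b n : -1 < a -> -1 < b -> (0 < n)%N ->
  kQ a b n * (b + 1) * integ a b ((1 - 'X) * (tjac a b n)^`()) = - (tjac a b n).[0].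
Proof.
move=> a1 b1; case: n => // m _; rewrite integ_UdP_val // tjac_at0 // /kQ /=.
have p0 := param_gt0 a1 b1; have pa := parama_gt0 a1.
rewrite [poch (a + b + 2) m.+1]pochS [poch (b + 1) _]pochSl exprS.
have -> : b + 1 + 1 = b + 2 by ring.
have -> : a + b + 2 + m%:R = m.+1%:R + a + b + 1 by rewrite -natr1; ring.
have h3 : m.+1%:R + a + b + 1 != 0.
  by rewrite gt_eqF // -natr1; have := ler0n R m; move: p0; lra.
move: (m.+1%:R + a + b + 1) h3 => y h3.
by field; rewrite fact_neq0 h3 !poch_neq0.
Qed.

Lemma kQ_integ' a b n : -1 < a -> -1 < b -> (0 < n)%N ->
  kQ b a n * (a + 1) * integ a b ('X * (tjac a b n)^`()) = (tjac a b n).[1].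
Proof.
move=> a1 b1 n0; rewrite -['X * _]mulr1 integ_XdP // mir1 mulr1.
rewrite mulrCA kQ_integ // tjac_at0 // tjac_at1 mulNr mulrN opprK signrMK.
by [].
Qed.

(** This relation of the prefactors makes the terms of order [M N] cancel in the orthogonality
    relation. *)
Lemma kS_kQ a b n : -1 < a -> -1 < b -> (0 < n)%N ->
  kS a b n = kQ a b n * kQ b a n * jlam a b n.
Proof.
move=> a1 b1; case: n => // m _; rewrite /kS /kQ /jlam /=.
have p0 := param_gt0 a1 b1; have pa := parama_gt0 a1; have pb := paramb_gt0 b1.
rewrite [poch (a + b + 2) m.+1]pochS [poch (b + 1) _]pochSl [poch (a + 1) _]pochSl.
have -> : b + 1 + 1 = b + 2 by ring.
have -> : a + 1 + 1 = a + 2 by ring.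
have ha : poch (a + 2) m != 0 by apply: poch_neq0; move: pa; lra.
have hb : poch (b + 2) m != 0 by apply: poch_neq0; move: pb; lra.
rewrite [b + a]addrC factSr -natr1.
have h1 : a + 1 != 0 by rewrite gt_eqF.
have h2 : b + 1 != 0 by rewrite gt_eqF.
by field; rewrite h1 h2 ha hb fact_neq0 natS_neq0.
Qed.

Lemma integ_tQ a b n f : -1 < a -> -1 < b -> (0 < n)%N -> (size f <= n)%N ->
  integ a b (tQ a b n * f) = - ((tjac a b n).[0] * f.[0]).
Proof.
move=> a1 b1 n0 sf; rewrite -mulNr -kQ_integ // /tQ eqn0Ngt n0 /=.
rewrite -scalerAl mulrDl -!scalerAl integZ integD !integZ.
by rewrite integ_tjac_orth // integ_UdP_const //; ring.
Qed.

Lemma integ_tR a b n f : -1 < a -> -1 < b -> (0 < n)%N -> (size f <= n)%N ->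
  integ a b (tR a b n * f) = - ((tjac a b n).[1] * f.[1]).
Proof.
move=> a1 b1 n0 sf; rewrite -kQ_integ' // /tR eqn0Ngt n0 /=.
rewrite -scalerAl mulrBl -!scalerAl integZ integB !integZ.
by rewrite integ_tjac_orth // integ_XdP_const //; ring.
Qed.

Lemma integ_tS a b n f : -1 < a -> -1 < b -> (0 < n)%N -> (size f <= n)%N ->
  integ a b (tS a b n * f) = - ((tR a b n).[0] * f.[0] + (tQ a b n).[1] * f.[1]).
Proof.
move=> a1 b1 n0 sf; rewrite tQ_at1 // tR_at0 // -kQ_integ' //.
rewrite -[(tjac a b n).[0]]opprK -kQ_integ // /tS eqn0Ngt n0 /= kS_kQ //.
rewrite -scalerAl mulrBl mulrDl -!scalerAl integZ integB integD !integZ.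
by rewrite integ_tjac_orth // integ_XdP_const // integ_UdP_const //; ring.
Qed.

(** The integrals of [tQ], [tR], [tS] cancel the point mass terms of order [M], [N] and [M N]; the
    zeros of these polynomials at the end points remove all terms of higher order. *)
Lemma tY_orth a b M N n f : -1 < a -> -1 < b -> (size f <= n)%N ->
  form a b M N (tY a b M N n) f = 0.
Proof.
move=> a1 b1 sf; case: (posnP n) => [n0|n0].
  move: sf; rewrite n0 leqn0 size_poly_eq0 => /eqP ->.
  by rewrite /form mulr0 integ0 !horner0 !mulr0 !addr0.
rewrite /form /tY !mulrDl -!scalerAl !integD !integZ integ_tjac_orth //.
rewrite integ_tQ // integ_tR // integ_tS // !hornerD !hornerZ.
by rewrite tQ_at0 tR_at1 // tS_at0 // tS_at1 //; ring.
Qed.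

Lemma form_pos a b M N f : -1 < a -> -1 < b -> 0 <= M -> 0 <= N -> f != 0 ->
  0 < form a b M N f f.
Proof.
move=> a1 b1 M0 N0 f0; apply: ltr_wpDr; last apply: ltr_wpDr.
- by rewrite mulr_ge0 // -expr2 sqr_ge0.
- by rewrite mulr_ge0 // -expr2 sqr_ge0.
- exact: integ_pos.
Qed.

End Koornwinder.

(** * Symmetry of the operators *)

Section Bilinear.
Variable R : realType.
Implicit Types (F G : {poly R} -> {poly R} -> R) (f g h : {poly R}).

Definition bilin F :=
  (forall c f g h, F (c *: f + g) h = c * F f h + F g h) /\
  (forall c f g h, F h (c *: f + g) = c * F h f + F h g).

Lemma bilin0l F f : bilin F -> F 0 f = 0.
Proof.
by move=> [Fl _]; have := Fl (-1) 0 0 f; rewrite scaler0 addr0 mulN1r addNr.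
Qed.

Lemma bilin0r F f : bilin F -> F f 0 = 0.
Proof.
by move=> [_ Fr]; have := Fr (-1) 0 0 f; rewrite scaler0 addr0 mulN1r addNr.
Qed.

Lemma bilinDl F f g h : bilin F -> F (f + g) h = F f h + F g h.
Proof. by move=> [Fl _]; rewrite -[f in LHS]scale1r Fl mul1r. Qed.

Lemma bilinDr F f g h : bilin F -> F h (f + g) = F h f + F h g.
Proof. by move=> [_ Fr]; rewrite -[f in LHS]scale1r Fr mul1r. Qed.

Lemma bilinZl F c f h : bilin F -> F (c *: f) h = c * F f h.
Proof. by move=> bF; rewrite -[c *: f]addr0 (proj1 bF) bilin0l // addr0. Qed.

Lemma bilinZr F c f h : bilin F -> F h (c *: f) = c * F h f.
Proof. by move=> bF; rewrite -[c *: f]addr0 (proj2 bF) bilin0r // addr0. Qed.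

Lemma bilin_eq F G : bilin F -> bilin G ->
  (forall m n, F 'X^m 'X^n = G 'X^m 'X^n) -> forall f g, F f g = G f g.
Proof.
move=> bF bG E f g; elim/poly_lin_ind: f => [m|p q Hp Hq|c p Hp].
- elim/poly_lin_ind: g => [n|p q Hp Hq|c p Hp] //.
  + by rewrite !bilinDr // Hp Hq.
  + by rewrite !bilinZr // Hp.
- by rewrite !bilinDl // Hp Hq.
- by rewrite !bilinZl // Hp.
Qed.

(** Powers of [t] against powers of [1 - t] suit the Beta integral and are exchanged by the
    reflection. *)
Lemma bilin_eq_mir F G : bilin F -> bilin G ->
  (forall m n, F 'X^m ((1 - 'X) ^+ n) = G 'X^m ((1 - 'X) ^+ n)) ->
  forall f g, F f g = G f g.
Proof.
move=> bF bG E f g; elim/poly_lin_ind: f => [m|p q Hp Hq|c p Hp].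
- elim/poly_lin_ind_mir: g => [n|p q Hp Hq|c p Hp] //.
  + by rewrite !bilinDr // Hp Hq.
  + by rewrite !bilinZr // Hp.
- by rewrite !bilinDl // Hp Hq.
- by rewrite !bilinZl // Hp.
Qed.

Lemma bilin_flip F : bilin F -> bilin (fun f g => F g f).
Proof. by case. Qed.

End Bilinear.

(** * The operator of the coefficients [a_i] *)

Section OperatorA.
Variable R : realType.
Implicit Types (a b c x : R) (f g h : {poly R}) (n k m : nat).

(* [imA r] is the image of [t^r] under [opA], the operator
   [f |-> sum_(i >= 1) a_i D^i f] in the variable [t]; see [opA_coef]. *)
Definition imA a b r : {poly R} :=
  if r is m.+1 then
    (- (a + b + 2) * (poch (b + 3) m / poch (a + 1) m)) *:
    ('X * \poly_(k < m.+1) (binr (- b - 2) (m - k) * binr (a + b + 3) k))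
  else 0.

Definition opA a b : {poly R} -> {poly R} := extend (imA a b).

HB.instance Definition _ a b := GRing.Linear.on (opA a b).

Lemma opAXn a b n : opA a b 'X^n = imA a b n.
Proof. exact: extendXn. Qed.

Lemma opA_at0 a b f : (opA a b f).[0] = 0.
Proof.
elim/poly_lin_ind: f => [n|f g Hf Hg|c f Hf].
- rewrite opAXn; case: n => [|n] /=; first by rewrite horner0.
  by rewrite hornerZ hornerM hornerX mul0r mulr0.
- by rewrite linearD hornerD Hf Hg addr0.
- by rewrite linearZ hornerZ Hf mulr0.
Qed.

(** At [t = 1] the coefficients add up to a convolution whose parameters [- b - 2] and [a + b + 3]
    have sum [a + 1], which cancels the denominator [(a + 1)_m]. *)
Lemma imA_at1 a b m : -1 < a ->
  (imA a b m.+1).[1] = - (a + b + 2) * (poch (b + 3) m / m`!%:R).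
Proof.
move=> a1; rewrite /imA hornerZ hornerM hornerX mul1r horner_poly.
rewrite (eq_bigr (fun k : 'I_m.+1 => binr (- b - 2) (m - k) * binr (a + b + 3) k));
  last by move=> k _; rewrite expr1n mulr1.
rewrite -/(conv _ _ _) binr_conv /binr.
have -> : - b - 2 + (a + b + 3) = a + 1 by ring.
have h := poch_neq0 m (parama_gt0 a1).
by field; rewrite h fact_neq0.
Qed.

(** The commutator of [opA] with multiplication by [t], evaluated at [t = 1]. *)
Definition jumpA a b f : R := (opA a b ('X * f)).[1] - (opA a b f).[1].

Lemma jumpA_Xn a b n : -1 < a ->
  jumpA a b 'X^n = - (a + b + 2) * (poch (b + 2) n / n`!%:R).
Proof.
move=> a1; rewrite /jumpA -exprS !opAXn imA_at1 //; case: n => [|m].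
  by rewrite /= horner0 !poch0 subr0.
rewrite imA_at1 // pochS [poch (b + 2) _]pochSl factSr.
have -> : b + 2 + 1 = b + 3 by ring.
by field; rewrite fact_neq0 natS_neq0.
Qed.

Lemma bilin_integ a b (T : {linear {poly R} -> {poly R}}) :
  bilin (fun f g => integ a b (T f * g)).
Proof.
split=> c f g h.
- by rewrite linearP mulrDl -scalerAl integD integZ.
- by rewrite mulrDr -scalerAr integD integZ.
Qed.

Lemma bilin_horner (T : {linear {poly R} -> {poly R}}) x y :
  bilin (fun f g => (T f).[x] * g.[y]).
Proof.
split=> c f g h; first by rewrite linearP hornerD hornerZ; ring.
by rewrite hornerD hornerZ; ring.
Qed.

Lemma bilinD (F G : {poly R} -> {poly R} -> R) :
  bilin F -> bilin G -> bilin (fun f g => F f g + G f g).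
Proof.
by move=> [Fl Fr] [Gl Gr]; split=> c f g h; rewrite ?Fl ?Gl ?Fr ?Gr; ring.
Qed.

Section Symmetry.
Variables (a b : R).
Hypotheses (a1 : -1 < a) (b1 : -1 < b).

(** The coefficient of [M] in [form a b M N (opM a b M N f) g]; the second term comes from the mass
    at [t = 0]. *)
Definition formA f g : R := integ a b (opA a b f * g) + (jacL a b f).[0] * g.[0].

Lemma bilin_formA : bilin formA.
Proof. by apply: bilinD; [apply: bilin_integ|apply: bilin_horner]. Qed.

(** Term by term integration gives a convolution in which [- b - 2] is exactly the parameter of
    Euler's transformation, so the sum closes. *)
Lemma integ_imA m n : integ a b (imA a b m.+1 * 'X^n) =
  - (a + b + 2) * poch (b + 3) m * poch (b + 1) n.+1 * poch n%:R m
  / (m`!%:R * poch (a + b + 2) (n.+1 + m)).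
Proof.
have p0 := param_gt0 a1 b1; have pa := parama_gt0 a1.
have p1 : 0 < a + b + 2 + n.+1%:R by rewrite ltr_wpDr ?ler0n.
rewrite /= -scalerAl integZ.
have -> : integ a b ('X * (\poly_(k < m.+1) (binr (- b - 2) (m - k) * binr (a + b + 3) k)) * 'X^n)
  = poch (b + 1) n.+1 / poch (a + b + 2) n.+1 *
    conv (binr (- b - 2)) (F21 (a + b + 3) (b + 1 + n.+1%:R) (a + b + 2 + n.+1%:R)) m.
  rewrite poly_def mulr_sumr mulr_suml integ_sum mulr_sumr; apply: eq_bigr => k _.
  rewrite -scalerAr -scalerAl integZ -exprS -exprD integXn addSn addnC -addSn !pochD.
  rewrite /F21 /binr.
  by field; rewrite !fact_neq0 !poch_neq0.
have -> : - b - 2 = a + b + 2 + n.+1%:R - (a + b + 3) - (b + 1 + n.+1%:R).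
  by ring.
rewrite Euler_transform //.
have -> : a + b + 2 + n.+1%:R - (a + b + 3) = n%:R by rewrite -natr1; ring.
have -> : a + b + 2 + n.+1%:R - (b + 1 + n.+1%:R) = a + 1 by ring.
rewrite /F21 [poch (a + b + 2) (_ + _)]pochD.
by field; rewrite !fact_neq0 !poch_neq0.
Qed.

(** The factor [(0)_m] kills the integral of the image of [t^(m+1)], except for [t] itself, where
    the boundary term compensates it. *)
Lemma formA_Xn0 m : formA 'X^m 1 = 0.
Proof.
have p0 := param_gt0 a1 b1.
rewrite /formA opAXn hornerC horner_coef0 coef_jacL !mul0r subr0 !mulr1.
case: m => [|m]; first by rewrite /= integ0 coefXn !mulr0 addr0.
rewrite -[imA a b m.+1]mulr1 -(expr0 'X) integ_imA; case: m => [|m].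
  rewrite coefXn eqxx mulr1 addn0 !poch1 !poch0 fact0.
  by field; rewrite gt_eqF.
by rewrite coefXn [poch 0%:R _]pochSl /= !mulr0n !(mul0r, mulr0) addr0.
Qed.

Lemma formA_sym f g : formA f g = formA g f.
Proof.
move: f g; apply: bilin_eq; [exact: bilin_formA|exact/bilin_flip/bilin_formA|].
have H0 n : formA 1 'X^n = 0.
  rewrite /formA -[1 : {poly R}]/('X^0) opAXn /= mul0r integ0 add0r.
  by rewrite horner_coef0 coef_jacL !coefXn /= !(mulr0n, mul0r, mulr0) subr0 mul0r.
case=> [|m] [|n] //.
- by rewrite expr0 H0 formA_Xn0.
- by rewrite expr0 H0 formA_Xn0.
rewrite /formA !hornerXn !expr0n /= !mulr0 !addr0 !opAXn !integ_imA !poch_fact.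
(* Taking out [(b + 1) (b + 2)] leaves the symmetric product of [(b + 3)_m] and [(b + 3)_n]. *)
rewrite [poch (b + 1) n.+2]pochSl [poch (b + 1) m.+2]pochSl !(pochSl (b + 1 + 1)).
have -> : b + 1 + 1 + 1 = b + 3 by ring.
rewrite [(m.+2 + n)%N]addnC [(n.+2 + m)%N]addnC !addnS [(m + n)%N]addnC.
have p0 := param_gt0 a1 b1.
by field; rewrite !fact_neq0 !poch_neq0.
Qed.

End Symmetry.
End OperatorA.

(** * The operator of the coefficients [c_i] and the full operator *)

Section OperatorC.
Variable R : realType.
Implicit Types (a b c x : R) (f g h : {poly R}) (n k m : nat).

Definition constC a b : R :=
  (a + b + 2) ^+ 2 * (a + b + 3) * (a + b + 4) / ((a + 1) * (b + 1)).

(* [opE] is the commutator of [opC1], the operator of the [coef_c1], with the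
   multiplication by [t]. *)
Definition imE a b r : {poly R} :=
  if r is m.+1 then
    (constC a b * (poch (b + 3) m / m.+1`!%:R)) *:
    ('X^2 * (1 - 'X) *
     \poly_(k < m.+1) (binr (- a - b - 3) (m - k)
        * (poch (a + b + 5) k * poch (a + b + 4) k / (poch (b + 3) k * k`!%:R))))
  else 0.

Definition opE a b : {poly R} -> {poly R} := extend (imE a b).

HB.instance Definition _ a b := GRing.Linear.on (opE a b).

Lemma opEXn a b n : opE a b 'X^n = imE a b n.
Proof. exact: extendXn. Qed.

(** The operator is rebuilt from its commutator [opE] with [t] and its value [0] at the constant
    [1]; in this way no factor [1 / i] appears. *)
Fixpoint imC a b r : {poly R} :=
  if r is m.+1 then 'X * imC a b m + imE a b m else 0.

Definition opC1 a b : {poly R} -> {poly R} := extend (imC a b).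

HB.instance Definition _ a b := GRing.Linear.on (opC1 a b).

Lemma opC1Xn a b n : opC1 a b 'X^n = imC a b n.
Proof. exact: extendXn. Qed.

Lemma opC1_mulX a b f : opC1 a b ('X * f) = 'X * opC1 a b f + opE a b f.
Proof.
elim/poly_lin_ind: f => [n|f g Hf Hg|c f Hf].
- by rewrite -exprS !opC1Xn opEXn.
- by rewrite mulrDr !linearD /= Hf Hg; ring.
- by rewrite -scalerAr !linearZ /= Hf -!mul_polyC; ring.
Qed.

Lemma constC_sym a b : constC a b = constC b a.
Proof. by rewrite /constC [b + a]addrC [(b + 1) * _]mulrC. Qed.

Section Boundary.
Variables (a b : R).
Hypotheses (a1 : -1 < a) (b1 : -1 < b).

Lemma integ_poly_weight m q (c : nat -> R) :
  integ a b ('X^2 * (1 - 'X) * \poly_(k < m) c k * (1 - 'X) ^+ q) =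
  \sum_(k < m) c k * (poch (b + 1) (k + 2) * poch (a + 1) q.+1
                       / poch (a + b + 2) (k + 2 + q.+1)).
Proof.
have -> : 'X^2 * (1 - 'X) * \poly_(k < m) c k * (1 - 'X) ^+ q =
  \sum_(k < m) c k *: ('X^(k + 2) * (1 - 'X) ^+ q.+1) :> {poly R}.
  rewrite poly_def mulrAC mulr_sumr; apply: eq_bigr => k _.
  by rewrite -!mul_polyC exprD !exprS; ring.
by rewrite integ_sum; apply: eq_bigr => k _; rewrite integZ integ_XnUn.
Qed.

Lemma integ_imE m q : integ a b (imE a b m.+1 * (1 - 'X) ^+ q) =
  (a + b + 2) * poch (b + 2) m.+1 * poch (a + 2) q / m.+1`!%:R *
  \sum_(k < m.+1) poch (- a - b - 3) (m - k) * poch (a + b + 4) k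
     / ((m - k)`!%:R * k`!%:R * poch (a + b + 5 + k%:R) q).
Proof.
have p0 := param_gt0 a1 b1; have pa := parama_gt0 a1; have pb := paramb_gt0 b1.
rewrite /imE -scalerAl integZ integ_poly_weight !mulr_sumr; apply: eq_bigr => k _.
have b3 : 0 < b + 3 by move: pb; lra.
have p5 : 0 < a + b + 5 by move: p0; lra.
have p5k : 0 < a + b + 5 + k%:R by rewrite ltr_wpDr ?ler0n.
have -> : poch (b + 1) (k + 2) = (b + 1) * (b + 2) * poch (b + 3) k.
  rewrite addn2 !pochSl; have -> : b + 1 + 1 = b + 2 by ring.
  by rewrite (_ : b + 2 + 1 = b + 3) ?mulrA; last ring.
have -> : poch (a + 1) q.+1 = (a + 1) * poch (a + 2) q.
  by rewrite pochSl; have -> : a + 1 + 1 = a + 2 by ring.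
have -> : poch (a + b + 2) (k + 2 + q.+1) = (a + b + 2) * (a + b + 3) * (a + b + 4)
    * (poch (a + b + 5) k * poch (a + b + 5 + k%:R) q).
  rewrite -pochD (_ : k + 2 + q.+1 = (k + q).+3)%N; last by lia.
  rewrite !pochSl !mulrA; have -> : a + b + 2 + 1 = a + b + 3 by ring.
  have -> : a + b + 3 + 1 = a + b + 4 by ring.
  by have -> : a + b + 4 + 1 = a + b + 5 by ring.
rewrite [poch (b + 2) _]pochSl (_ : b + 2 + 1 = b + 3); last by ring.
rewrite /constC /binr.
have h1 : a + 1 != 0 by rewrite gt_eqF.
have h2 : b + 1 != 0 by rewrite gt_eqF.
have h3 : a + b + 2 != 0 by rewrite gt_eqF.
have h4 : a + b + 3 != 0 by rewrite gt_eqF //; move: p0; lra.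
have h5 : a + b + 4 != 0 by rewrite gt_eqF //; move: p0; lra.
have h6 := poch_neq0 k b3; have h7 := poch_neq0 k p5; have h8 := poch_neq0 q p5k.
move: (poch (a + b + 5 + k%:R) q) h8 => y h8.
by field; rewrite h1 h2 h3 h4 h5 h6 h7 h8 !fact_neq0.
Qed.

(** What [formC1] gains when a factor [t] moves from the first to the second argument; see
    [formC1_mulX]. *)
Definition formE f g : R := integ a b (opE a b f * g) + jumpA a b f * g.[1].

Lemma bilin_formE : bilin formE.
Proof.
apply: bilinD; first exact: bilin_integ.
split=> c f g h; last by rewrite hornerD hornerZ; ring.
by rewrite /jumpA mulrDr -scalerAr !linearP /= !hornerD !hornerZ; ring.
Qed.

Lemma formE_XnUn m q : formE 'X^(m.+1) ((1 - 'X) ^+ q.+1) =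
  (a + b + 2) * poch (b + 2) m.+1 * poch (a + 2) q.+1 * rho (a + b + 4) m q.
Proof.
rewrite /formE opEXn integ_imE horner_exp hornerU subrr expr0n mulr0 addr0.
rewrite /rho -mulr_suml mulrA [RHS]mulrAC; congr (_ * _); apply: eq_bigr => k _.
have -> : 1 - (a + b + 4) = - a - b - 3 by ring.
by have -> : a + b + 4 + 1 = a + b + 5 by ring.
Qed.

(** The parameters [- a - b - 3] and [a + b + 4] add up to [1], so the convolution equals [1] and
    the integral cancels the jump of [opA]. *)
Lemma formE_Xn_1 m : formE 'X^(m.+1) 1 = 0.
Proof.
rewrite /formE opEXn -(expr0 (1 - 'X)) integ_imE expr0 hornerC mulr1 jumpA_Xn //.
rewrite (_ : \sum_(k < m.+1) _ = conv (binr (- a - b - 3)) (binr (a + b + 4)) m).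
  rewrite binr_conv; have -> : - a - b - 3 + (a + b + 4) = 1%:R by ring.
  rewrite /binr poch_fact add0n fact0 poch0; field.
  by rewrite !fact_neq0.
apply: eq_bigr => k _; rewrite poch0 /binr; field.
by rewrite !fact_neq0.
Qed.

Lemma formE_1_Un q : formE 1 ((1 - 'X) ^+ q.+1) = 0.
Proof.
rewrite /formE -(expr0 'X) opEXn mul0r integ0 add0r horner_exp hornerU subrr.
by rewrite expr0n mulr0.
Qed.

Lemma formE_1_1 : formE 1 1 = - (a + b + 2).
Proof.
rewrite /formE -(expr0 'X) opEXn mul0r integ0 add0r jumpA_Xn // expr0 hornerC.
by rewrite !poch0 fact0 divr1 !mulr1.
Qed.

End Boundary.

(** For [t^(m+1)] against [(1 - t)^(n+1)] this is [rho_sym]; the two remaining Pochhammer factors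
    trade places. *)
Lemma formE_mir a b f g : -1 < a -> -1 < b ->
  formE a b f g = formE b a (mir g) (mir f).
Proof.
move=> a1 b1; move: f g; apply: bilin_eq_mir; first exact: bilin_formE.
  have [Bl Br] := bilin_formE b a.
  by split=> c f g h; rewrite linearP /= ?Bl ?Br.
move=> m n; have -> : mir ((1 - 'X) ^+ n) = 'X^n :> {poly R} by rewrite -mirXn mirK.
rewrite mirXn; case: m n => [|m] [|n]; rewrite ?expr0.
- by rewrite !formE_1_1 // [b + a]addrC.
- by rewrite formE_1_Un // formE_Xn_1.
- by rewrite formE_1_Un // formE_Xn_1.
rewrite !formE_XnUn // [b + a]addrC (@rho_sym _ _ m n).
  by rewrite (mulrAC _ _ (poch (a + 2) _)).
by have := param_gt0 a1 b1; lra.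
Qed.

Definition opB a b f : {poly R} := mir (opA b a (mir f)).

Lemma opB_is_linear a b : linear (opB a b).
Proof. by move=> c u v; rewrite /opB !linearP. Qed.

HB.instance Definition _ a b := GRing.isLinear.Build R {poly R} {poly R} _
  (opB a b) (opB_is_linear a b).

Definition opC a b f : {poly R} := opC1 a b f + mir (opC1 b a (mir f)).

Lemma opC_is_linear a b : linear (opC a b).
Proof. by move=> c u v; rewrite /opC !linearP /= scalerDr addrACA. Qed.

HB.instance Definition _ a b := GRing.isLinear.Build R {poly R} {poly R} _
  (opC a b) (opC_is_linear a b).

Lemma opB_at1 a b f : (opB a b f).[1] = 0.
Proof. by rewrite horner_mir subrr opA_at0. Qed.

Lemma imE_at a b n : (imE a b n).[0] = 0 /\ (imE a b n).[1] = 0.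
Proof.
case: n => [|n]; first by rewrite /= !horner0.
rewrite /imE !hornerZ !hornerM !hornerU !hornerX subrr.
by rewrite !(mul0r, mulr0).
Qed.

Lemma opC1_at a b f : (opC1 a b f).[0] = 0 /\ (opC1 a b f).[1] = 0.
Proof.
elim/poly_lin_ind: f => [n|f g [Hf0 Hf1] [Hg0 Hg1]|c f [Hf0 Hf1]].
- rewrite opC1Xn; elim: n => [|n [IH0 IH1]] /=; first by rewrite !horner0.
  have [E0 E1] := imE_at a b n.
  by rewrite !hornerD !hornerM E0 E1 IH0 IH1 !mulr0 addr0.
- by rewrite linearD !hornerD Hf0 Hf1 Hg0 Hg1 addr0.
- by rewrite linearZ !hornerZ Hf0 Hf1 !mulr0.
Qed.

Lemma opC_at0 a b f : (opC a b f).[0] = 0.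
Proof.
by rewrite hornerD horner_mir subr0 (opC1_at a b f).1 (opC1_at _ _ _).2 addr0.
Qed.

Lemma opC_at1 a b f : (opC a b f).[1] = 0.
Proof.
by rewrite hornerD horner_mir subrr (opC1_at a b f).2 (opC1_at _ _ _).1 addr0.
Qed.

Section Symmetry.
Variables (a b : R).
Hypotheses (a1 : -1 < a) (b1 : -1 < b).

Definition formC1 a b f g : R :=
  integ a b (opC1 a b f * g) + (opA a b f).[1] * g.[1].

Lemma bilin_formC1 a' b' : bilin (formC1 a' b').
Proof. by apply: bilinD; [apply: bilin_integ|apply: bilin_horner]. Qed.

Lemma formC1_mulX a' b' f g :
  formC1 a' b' ('X * f) g = formC1 a' b' f ('X * g) + formE a' b' f g.
Proof.
rewrite /formC1 /formE /jumpA opC1_mulX mulrDl integD hornerM hornerX mul1r.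
have -> : 'X * opC1 a' b' f * g = opC1 a' b' f * ('X * g) by ring.
by ring.
Qed.

(** The coefficient of [M N] in [form a b M N (opM a b M N f) g]: [opB] meets the mass at [t = 0]
    and [opA] the mass at [t = 1]. *)
Definition formC f g : R :=
  integ a b (opC a b f * g) + (opB a b f).[0] * g.[0] + (opA a b f).[1] * g.[1].

Lemma formC_split f g : formC f g = formC1 a b f g + formC1 b a (mir f) (mir g).
Proof.
rewrite /formC /formC1 /opC mulrDl integD [integ a b (mir _ * g)]integ_mirr //.
rewrite mirM mirK /opB !horner_mir subr0 subrr.
by ring.
Qed.

(** The reflected half of [formC] sees [1 - t] in place of [t], hence the opposite sign, and
    [formE_mir] brings its contribution back to the parameters [a], [b]. *)
Lemma formC_mulX f g :
  formC ('X * f) g = formC f ('X * g) + formE a b f g - formE a b g f.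
Proof.
have bF := bilin_formC1 b a.
rewrite !formC_split formC1_mulX !mirM mirX !mulrBl !mul1r -!scaleN1r.
rewrite !bilinDl // !bilinDr // !bilinZl // !bilinZr // formC1_mulX.
by rewrite [formE a b g f]formE_mir //; ring.
Qed.

Lemma bilin_formC : bilin formC.
Proof.
apply: bilinD; last exact: bilin_horner.
by apply: bilinD; [apply: bilin_integ|apply: bilin_horner].
Qed.

(* The antisymmetric part of [formC] is unchanged when a factor ['X] moves from
   one argument to the other, so it depends on the product only. *)
Lemma formC_sym f g : formC f g = formC g f.
Proof.
move: f g; apply: bilin_eq; [exact: bilin_formC|exact/bilin_flip/bilin_formC|].
pose H f g := formC f g - formC g f.
have HX f g : H ('X * f) g = H f ('X * g).
  by rewrite /H formC_mulX [formC ('X * g) f]formC_mulX; ring.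
have HXn n f g : H ('X^n * f) g = H f ('X^n * g).
  elim: n f g => [|n IH] f g; first by rewrite expr0 !mul1r.
  by rewrite exprSr -!mulrA IH HX mulrCA.
(* [H] is antisymmetric, and moving ['X^n] across exchanges the two arguments. *)
have H1 n : H 'X^n 1 = 0.
  have := HXn n 1 1; rewrite !mulr1 {2}/H -opprB -/(H _ _) => /eqP.
  by rewrite -subr_eq0 opprK -mulr2n mulrn_eq0 /= => /eqP.
move=> m n; apply/eqP; rewrite -subr_eq0 -/(H _ _); apply/eqP.
by rewrite -['X^n]mulr1 -HXn -exprD H1.
Qed.

Definition opM M N f : {poly R} :=
  jacL a b f + M *: opA a b f + N *: opB a b f + (M * N) *: opC a b f.

Lemma opM_is_linear M N : linear (opM M N).
Proof.
by move=> c u v; rewrite /opM !linearP /= -!mul_polyC; ring.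
Qed.

HB.instance Definition _ M N := GRing.isLinear.Build R {poly R} {poly R} _
  (opM M N) (opM_is_linear M N).

End Symmetry.

Lemma formB_sym a b f g : -1 < a -> -1 < b ->
  integ a b (opB a b f * g) + (jacL a b f).[1] * g.[1] =
  integ a b (opB a b g * f) + (jacL a b g).[1] * f.[1].
Proof.
move=> a1 b1; have := formA_sym b1 a1 (mir f) (mir g); rewrite /formA.
rewrite !jacL_mir !horner_mir subr0 => E.
by rewrite !(integ_mirr (_ * _) a1 b1) !mirM !mirK.
Qed.

Lemma opM_horner a b M N f x : (opM a b M N f).[x] =
  (jacL a b f).[x] + M * (opA a b f).[x] + N * (opB a b f).[x]
  + M * N * (opC a b f).[x].
Proof.
rewrite /opM; move: (jacL a b f) (opA a b f) (opB a b f) (opC a b f) => p q r s.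
by rewrite !hornerD !hornerZ.
Qed.

(** The zeros of [opA], [opB] and [opC] at the end points remove the mixed terms of higher order in
    [M] and [N]; the coefficients of [1], [M], [N] and [M N] are symmetric forms. *)
Lemma opM_sym a b M N f g : -1 < a -> -1 < b ->
  form a b M N (opM a b M N f) g = form a b M N (opM a b M N g) f.
Proof.
move=> a1 b1.
have E h (k : {poly R}) : form a b M N (opM a b M N h) k =
  integ a b (jacL a b h * k) + M * formA a b h k
  + N * (integ a b (opB a b h * k) + (jacL a b h).[1] * k.[1])
  + M * N * formC a b h k.
  rewrite /form /formA /formC !opM_horner opA_at0 opB_at1 opC_at0 opC_at1.
  have -> : integ a b (opM a b M N h * k) = integ a b (jacL a b h * k)
     + M * integ a b (opA a b h * k) + N * integ a b (opB a b h * k)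
     + M * N * integ a b (opC a b h * k).
    rewrite /opM; move: (jacL a b h) (opA a b h) (opB a b h) (opC a b h) => p q r s.
    by rewrite !mulrDl -!scalerAl !integD !integZ.
  by ring.
by rewrite !E jacL_sym // formA_sym // formB_sym // formC_sym.
Qed.

End OperatorC.

(** * Eigenvalues *)

Section Triangular.
Variable R : realType.
Implicit Types (f g : {poly R}) (c : nat -> R) (n k m : nat).

Lemma size_add_leq n f g : (size f <= n)%N -> (size g <= n)%N -> (size (f + g)%R <= n)%N.
Proof.
by move=> fn gn; apply: leq_trans (size_polyD _ _) _; rewrite geq_max fn gn.
Qed.

Lemma size_scale_le n (x : R) f : (size f <= n)%N -> (size (x *: f) <= n)%N.
Proof. exact/leq_trans/size_scale_leq. Qed.

Lemma split_lead n f : (size f <= n.+1)%N ->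
  exists2 g : {poly R}, (size g <= n)%N & f = g + f`_n *: 'X^n.
Proof.
move=> fn; exists (f - f`_n *: 'X^n); last by rewrite subrK.
have := size_cancel_lead (size_polyXn R n) fn.
by rewrite coefXn eqxx divr1.
Qed.

Variable T : {linear {poly R} -> {poly R}}.

(** The diagonal entries are [- c n], in accordance with the sign of [jlam]. *)
Definition triangular c := forall n, (size (T 'X^n + c n *: 'X^n)%R <= n)%N.

Lemma triangular_size c n f : triangular c -> (size f <= n)%N -> (size (T f) <= n)%N.
Proof.
move=> tT; elim: n f => [|n IH] f.
  by rewrite leqn0 size_poly_eq0 => /eqP ->; rewrite linear0 size_poly0.
case/split_lead => g gn ->; rewrite linearD linearZ /=.
apply: size_add_leq; first exact/leqW/IH.
apply: size_scale_le; rewrite -[T _](addrK (c n *: 'X^n)).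
apply: size_add_leq; first exact/leqW/tT.
by rewrite size_polyN; apply: size_scale_le; rewrite size_polyXn.
Qed.

Lemma triangular_lead c n f : triangular c -> (size f <= n.+1)%N ->
  (size (T f + c n *: f)%R <= n)%N.
Proof.
move=> tT; case/split_lead => g gn; move: (f`_n) => x ->.
rewrite linearD linearZ scalerDr /= addrACA.
apply: size_add_leq.
  by apply: size_add_leq; [apply: triangular_size tT gn|apply: size_scale_le].
by rewrite scalerA mulrC -scalerA -scalerDr; apply: size_scale_le.
Qed.

End Triangular.

Section MirrorTriangular.
Variable R : realType.
Implicit Types (f g : {poly R}) (c : nat -> R) (n k m : nat).

(** The second coefficient enters because [opE] raises degrees by two, while the top terms of its
    two reflected copies cancel. *)
Lemma coef_mir_sublead n f : (size f <= n.+2)%N ->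
  (mir f)`_n = (-1) ^+ n * (f`_n + n.+1%:R * f`_n.+1).
Proof.
have U k : ((1 - 'X) ^+ k.+1 : {poly R})`_k = (-1) ^+ k * k.+1%:R.
  elim: k => [|k IH]; first by rewrite expr1 coefB coef1 coefX subr0 mulr1.
  rewrite exprSr mulrBr mulr1 coefB coefMX /= IH -mirXn coef_mir_lead ?size_polyXn //.
  by rewrite coefXn eqxx mulr1n exprS -[in RHS]natr1; ring.
case/split_lead => g gn E.
rewrite {1 2}E linearD linearZ /= !coefD !coefZ mirXn U coef_mir_lead // coefXn.
by rewrite (ltn_eqF (ltnSn n)) mulr0 addr0; ring.
Qed.

End MirrorTriangular.

(** * Diagonal entries and the eigenvalue equation *)

Section DiagonalEntries.
Variable R : realType.
Implicit Types (a b : R) (f g : {poly R}) (n k m : nat).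

Lemma jacL_triangular a b : triangular (jacL a b) (jlam a b).
Proof.
move=> n; apply/leq_sizeP => k nk.
rewrite coefD coef_jacL coefZ !coefXn gtn_eqF ?ltnS // mulr0 sub0r.
by case: eqP => [->|_]; rewrite ?mulr1n ?mulr0n /jlam; ring.
Qed.

Lemma coef_b0_sym a b n : coef_b0 a b n = coef_a0 b a n.
Proof. by rewrite /coef_b0 /coef_a0 [b + a]addrC. Qed.

Lemma opA_triangular a b : triangular (opA a b) (coef_a0 a b).
Proof.
move=> n; rewrite /= opAXn; case: n => [|m]; first by rewrite /= add0r scale0r size_poly0.
apply: size_leq_coef0.
  apply: size_add_leq; last by apply: size_scale_le; rewrite size_polyXn.
  apply: size_scale_le; apply: leq_trans (size_polyMleq _ _) _.
  by rewrite size_polyX /= ltnS size_poly.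
rewrite coefD !coefZ coefXn eqxx coefXM /= coef_poly ltnSn subnn.
by rewrite /binr poch0 fact0 /coef_a0 /= -mulf_div divr1; ring.
Qed.

Lemma opB_triangular a b : triangular (opB a b) (coef_b0 a b).
Proof.
move=> n; rewrite coef_b0_sym /= /opB.
have -> : mir (opA b a (mir 'X^n)) + coef_a0 b a n *: 'X^n =
    mir (opA b a (mir 'X^n) + coef_a0 b a n *: mir 'X^n).
  by rewrite linearD linearZ /= mirK.
by rewrite size_mir (triangular_lead (opA_triangular b a)) // size_mir size_polyXn.
Qed.

(** The commutator of [opC] with multiplication by [t]; the minus sign stems from the reflection of
    [t] to [1 - t]. *)
Definition diffE a b f : {poly R} := opE a b f - mir (opE b a (mir f)).

Lemma opC_mulX a b f : opC a b ('X * f) = 'X * opC a b f + diffE a b f.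
Proof.
rewrite /opC /diffE opC1_mulX mirM mirX mulrBl mul1r.
have -> : opC1 b a (mir f - 'X * mir f) =
    opC1 b a (mir f) - ('X * opC1 b a (mir f) + opE b a (mir f)).
  by rewrite linearB /= opC1_mulX.
rewrite (linearB (mir (R := R))) (linearD (mir (R := R))) /= mirM mirX.
by ring.
Qed.

(** Minus the leading coefficient of [imE a b m.+1], and at the same time [c_0(m + 2)]. *)
Definition topE a b m : R := constC a b *
  (poch (a + b + 5) m * poch (a + b + 4) m / (m.+1`!%:R * m`!%:R)).

Lemma topE_sym a b m : topE a b m = topE b a m.
Proof. by rewrite /topE constC_sym [b + a]addrC. Qed.

Definition subE a b m : R := topE a b m -
  if m is j.+1 then constC a b * (- a - b - 3) * (b + 3 + j%:R) *
    (poch (a + b + 5) j * poch (a + b + 4) j / (m.+1`!%:R * j`!%:R)) else 0.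

Lemma size_imE a b n : (size (imE a b n) <= n.+3)%N.
Proof.
case: n => [|m]; first by rewrite size_poly0.
apply: size_scale_le; apply: leq_trans (size_polyMleq _ _) _.
have : (size ('X^2 * (1 - 'X) : {poly R})%R <= 4)%N.
  apply: leq_trans (size_polyMleq _ _) _; rewrite size_polyXn /= -opprB size_polyN.
  by rewrite -[1]/(1%:P) size_XsubC.
have := size_poly m.+1 (fun k => binr (- a - b - 3) (m - k)
        * (poch (a + b + 5) k * poch (a + b + 4) k / (poch (b + 3) k * k`!%:R))).
by move: (size _) (size _) => s t; lia.
Qed.

Lemma coef_imE a b m : -1 < b ->
  (imE a b m.+1)`_m.+3 = - topE a b m /\ (imE a b m.+1)`_m.+2 = subE a b m.
Proof.
move=> b1; have b3 : 0 < b + 3 by move: b1; lra.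
rewrite /imE !coefZ; set Q := \poly_(k < _) _.
have -> : 'X^2 * (1 - 'X) * Q = Q * 'X * 'X - Q * 'X * 'X * 'X by ring.
rewrite !coefB !coefMX /= !coef_poly ltnn ltnSn subnn; split.
  rewrite /topE /binr poch0 fact0; have h := poch_neq0 m b3.
  by field; rewrite h !fact_neq0.
rewrite /subE /topE; case: m {Q} => [|j] /=.
  by rewrite /binr !poch0 !fact0 !(divr1, mulr1, subr0).
rewrite (ltnW (ltnSn j.+1)) subSnn /binr poch0 fact0 poch1 (_ : 1`! = 1%N) // [poch (b + 3) j.+1]pochS.
have h := poch_neq0 j b3.
have h' : b + 3 + j%:R != 0 by rewrite gt_eqF // ltr_wpDr // ler0n.
by field; rewrite h h' !fact_neq0.
Qed.

Lemma size_opE a b n f : (size f <= n.+1)%N -> (size (opE a b f) <= n.+3)%N.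
Proof.
move=> fn; rewrite /opE (extend_widen _ fn).
apply: (big_ind (fun g : {poly R} => (size g <= n.+3)%N)) => [|g h|i _].
- by rewrite size_poly0.
- exact: size_add_leq.
- apply: size_scale_le; apply: leq_trans (size_imE _ _ _) _.
  by rewrite !ltnS -ltnS.
Qed.

(** As [opE] raises degrees by at most two, only the two top coefficients of [f] matter above degree
    [n + 1]. *)
Lemma opE_split a b n f : (size f <= n.+2)%N ->
  exists2 g : {poly R}, (size g <= n.+2)%N &
    opE a b f = g + f`_n *: imE a b n + f`_n.+1 *: imE a b n.+1.
Proof.
case/split_lead => g1 /split_lead [g2 g2n E1] E2.
have fn : f`_n = g1`_n by rewrite E2 coefD coefZ coefXn ltn_eqF // mulr0 addr0.
exists (opE a b g2); last first.
  by rewrite fn {1}E2 linearD linearZ /= opEXn {1}E1 linearD linearZ /= opEXn.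
case: n {f E1 E2 fn} g2n => [|n] g2n; last exact: size_opE.
by move: g2n; rewrite leqn0 size_poly_eq0 => /eqP ->; rewrite linear0 size_poly0.
Qed.

Lemma coef_c0_topE a b j : -1 < a -> -1 < b -> coef_c0 a b j.+2 = topE a b j.
Proof.
move=> a1 b1; have h1 : a + 1 != 0 by rewrite gt_eqF ?parama_gt0.
have h2 : b + 1 != 0 by rewrite gt_eqF ?paramb_gt0.
rewrite /coef_c0 /topE /constC /= !subSS subn0 [poch _ j.+1]pochSl.
have -> : a + b + 4 + 1 = a + b + 5 by ring.
by field; rewrite h1 h2 !fact_neq0.
Qed.

Lemma diffE_lead a b m : -1 < a -> -1 < b ->
  (size (diffE a b 'X^m + (coef_c0 a b m.+1 - coef_c0 a b m) *: 'X^(m.+1))%R <= m.+1)%N.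
Proof.
move=> a1 b1; rewrite /diffE opEXn; case: m => [|m].
  rewrite mirXn expr0 -(expr0 'X) opEXn linear0 subr0 add0r.
  by rewrite /coef_c0 subrr scale0r size_poly0.
set f := mir 'X^(m.+1).
have sf : (size f <= m.+2)%N by rewrite size_mir size_polyXn.
have f1 : f`_m.+1 = (-1) ^+ m.+1.
  by rewrite coef_mir_lead ?size_polyXn // coefXn eqxx mulr1.
have f0 : f`_m = (-1) ^+ m * m.+1%:R.
  rewrite coef_mir_sublead ?size_polyXn // !coefXn eqxx ltn_eqF //.
  by rewrite mulr1n mulr0n add0r mulr1.
have [g gm Eh] := opE_split b a sf; set h := opE b a f in Eh *.
have sh : (size h <= m.+4)%N by apply: size_opE.
have [i3 i2] := coef_imE a m b1; have [j3 j2] := coef_imE b m a1.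
have hE k : h`_k = g`_k + f`_m * (imE b a m)`_k + f`_m.+1 * (imE b a m.+1)`_k.
  rewrite Eh; move: (imE b a m) (imE b a m.+1) => p q.
  by rewrite !coefD !coefZ.
have h3 : h`_m.+3 = (-1) ^+ m * topE a b m.
  rewrite hE j3 f1 (nth_default _ (leqW gm)).
  by rewrite (nth_default _ (size_imE b a m)) topE_sym exprS; ring.
have h2 : h`_m.+2 = (-1) ^+ m * (- (m.+1%:R * (if m is k.+1 then topE a b k else 0))
    - subE b a m).
  rewrite hE j2 f1 f0 (nth_default _ gm) exprS.
  case: m {f sf f1 f0 g gm h Eh hE sh i3 i2 j3 j2 h3} => [|k]; first by rewrite coef0; ring.
  by rewrite (proj1 (coef_imE b k a1)) topE_sym; ring.
have sm : (size (mir h) <= m.+4)%N by rewrite size_mir.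
(* In degree [m + 3] the two halves cancel by symmetry of [topE]; in degree [m + 2] they leave the
   difference of consecutive values of [c_0]. *)
apply: size_leq_coef0; first apply: size_leq_coef0.
- apply: size_add_leq; last first.
    by apply: size_scale_le; rewrite size_polyXn leqW.
  by apply: size_add_leq; rewrite ?size_imE // size_polyN.
- rewrite coefD coefB i3 coefZ coefXn gtn_eqF // mulr0 addr0 coef_mir_lead // h3.
  have -> : (-1) ^+ m.+3 * ((-1) ^+ m * topE a b m) =
      - ((-1) ^+ m * (-1) ^+ m) * topE a b m by rewrite !exprS; ring.
  by rewrite -expr2 sqrr_sign; ring.
rewrite coefD coefB i2 coefZ coefXn eqxx mulr1n coef_mir_sublead // h2 h3.
set z := (if m is _.+1 then _ else _).
have -> : (-1) ^+ m.+2 * ((-1) ^+ m * (- (m.+1%:R * z) - subE b a m)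
      + m.+3%:R * ((-1) ^+ m * topE a b m)) =
  ((-1) ^+ m * (-1) ^+ m) * (- (m.+1%:R * z) - subE b a m + m.+3%:R * topE a b m).
  by rewrite !exprS; ring.
rewrite -expr2 sqrr_sign mul1r {}/z.
rewrite coef_c0_topE // /subE (topE_sym b a).
case: m {f sf f1 f0 g gm h Eh hE sh i3 i2 j3 j2 h3 h2 sm} => [|k].
  by rewrite /coef_c0 /=; ring.
rewrite coef_c0_topE // constC_sym /topE [b + a]addrC [poch _ k.+1]pochS.
rewrite [poch (a + b + 4) _]pochS !factSr.
rewrite constC_sym; move: (constC a b) => K.
by field; rewrite fact_neq0 natS_neq0 nat2S_neq0.
Qed.

(** The diagonal entries are summed up from the differences supplied by the commutator with [t]. *)
Lemma opC_triangular a b : -1 < a -> -1 < b -> triangular (opC a b) (coef_c0 a b).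
Proof.
move=> a1 b1; elim=> [|n IH] /=.
  rewrite /opC (_ : mir 'X^0 = 'X^0); last by rewrite expr0 mir1.
  rewrite !opC1Xn /= linear0 addr0 add0r /coef_c0 /=.
  by rewrite scale0r size_poly0.
rewrite exprS opC_mulX -exprS.
have -> : 'X * opC a b 'X^n + diffE a b 'X^n + coef_c0 a b n.+1 *: 'X^(n.+1) =
  (opC a b 'X^n + coef_c0 a b n *: 'X^n) * 'X +
  (diffE a b 'X^n + (coef_c0 a b n.+1 - coef_c0 a b n) *: 'X^(n.+1)).
  by rewrite exprS -!mul_polyC polyCB; ring.
apply: size_add_leq; last exact: diffE_lead.
by apply: leq_trans (size_polyMleq _ _) _; rewrite size_polyX addn2.
Qed.

Lemma opM_lead a b M N n f : -1 < a -> -1 < b -> (size f <= n.+1)%N ->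
  (size (opM a b M N f + (jlam a b n + M * coef_a0 a b n + N * coef_b0 a b n
         + M * N * coef_c0 a b n) *: f)%R <= n)%N.
Proof.
move=> a1 b1 fn; rewrite /opM.
have HL : (size (jacL a b f + jlam a b n *: f)%R <= n)%N :=
  triangular_lead (jacL_triangular a b) fn.
have HA : (size (opA a b f + coef_a0 a b n *: f)%R <= n)%N :=
  triangular_lead (opA_triangular a b) fn.
have HB : (size (opB a b f + coef_b0 a b n *: f)%R <= n)%N :=
  triangular_lead (opB_triangular a b) fn.
have HC : (size (opC a b f + coef_c0 a b n *: f)%R <= n)%N :=
  triangular_lead (opC_triangular a1 b1) fn.
move: (jacL a b f) (opA a b f) (opB a b f) (opC a b f) HL HA HB HC => p q r s.
move: (jlam _ _ _) (coef_a0 _ _ _) (coef_b0 _ _ _) (coef_c0 _ _ _) => x y z w.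
move=> HL HA HB HC.
have -> : p + M *: q + N *: r + (M * N) *: s + (x + M * y + N * z + M * N * w) *: f =
  (p + x *: f) + M *: (q + y *: f) + N *: (r + z *: f) + (M * N) *: (s + w *: f).
  by rewrite -!mul_polyC !polyCD !polyCM; ring.
by do 3?[apply: size_add_leq; last exact: size_scale_le].
Qed.

Lemma size_opM a b M N n f : -1 < a -> -1 < b -> (size f <= n)%N ->
  (size (opM a b M N f) <= n)%N.
Proof.
move=> a1 b1; case: n => [|n] fn.
  by move: fn; rewrite leqn0 size_poly_eq0 => /eqP ->; rewrite linear0 size_poly0.
have := opM_lead M N a1 b1 fn; set c := (_ + _ + _ + _) => H.
rewrite -[opM _ _ _ _ _](addrK (c *: f)); apply: size_add_leq; first exact: leqW.
by rewrite size_polyN; apply: size_scale_le.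
Qed.

Lemma size_tY a b M N n : -1 < a -> -1 < b -> (size (tY a b M N n) <= n.+1)%N.
Proof.
move=> a1 b1.
have sP : (size (tjac a b n) <= n.+1)%N by rewrite size_tjac.
have sD : (size (tjac a b n)^`() <= n)%N.
  by rewrite -ltnS -(size_tjac n a1 b1) lt_size_deriv // tjac_neq0.
have sX : (size ('X * (tjac a b n)^`())%R <= n.+1)%N.
  by apply: leq_trans (size_polyMleq _ _) _; rewrite size_polyX.
have sU : (size ((1 - 'X) * (tjac a b n)^`())%R <= n.+1)%N.
  rewrite mulrBl mul1r; apply: size_add_leq; first exact: leqW.
  by rewrite size_polyN.
rewrite /tY /tQ /tR /tS; case: eqP => _; rewrite ?scaler0 ?addr0 //.
apply: size_add_leq; [apply: size_add_leq; [apply: size_add_leq => //|]|];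
  do 2!apply: size_scale_le.
- by apply: size_add_leq; apply: size_scale_le.
- by apply: size_add_leq; rewrite ?size_polyN; apply: size_scale_le.
- apply: size_add_leq; last by rewrite size_polyN; apply: size_scale_le.
  by apply: size_add_leq; apply: size_scale_le.
Qed.

(** The defect [D] has degree below [n], so it is orthogonal to [Y]; by symmetry its norm reduces to
    the product of [opM D] with [Y], which is zero for the same reason. Positivity gives [D = 0]. *)
Lemma opM_tY a b M N n : -1 < a -> -1 < b -> 0 <= M -> 0 <= N ->
  opM a b M N (tY a b M N n) = - (jlam a b n + M * coef_a0 a b n + N * coef_b0 a b n
         + M * N * coef_c0 a b n) *: tY a b M N n.
Proof.
move=> a1 b1 M0 N0; set c := _ + M * N * _; set Y := tY a b M N n.
have sY : (size Y <= n.+1)%N := size_tY M N n a1 b1.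
have := @opM_lead a b M N n Y a1 b1 sY; rewrite -/c; set D := _ + c *: Y => sD.
have formCC f g : form a b M N f g = form a b M N g f.
  by rewrite /form mulrC [f.[0] * _]mulrC [f.[1] * _]mulrC.
have formDl f g h : form a b M N (f + g) h = form a b M N f h + form a b M N g h.
  by rewrite /form mulrDl integD !hornerD; ring.
have formZl x f h : form a b M N (x *: f) h = x * form a b M N f h.
  by rewrite /form -scalerAl integZ !hornerZ; ring.
have DY : form a b M N D Y = 0 by rewrite formCC tY_orth.
have DD : form a b M N D D = 0.
  rewrite {1}/D formDl formZl [form _ _ _ _ Y D]formCC DY mulr0 addr0.
  by rewrite opM_sym // formCC tY_orth // size_opM.
apply/eqP; rewrite scaleNr -subr_eq0 opprK -/D.
by apply: contraT => D0; have := form_pos a1 b1 M0 N0 D0; rewrite DD ltxx.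
Qed.

End DiagonalEntries.

(** * The coefficients of the differential equation *)

Section Taylor.
Variable R : realType.
Implicit Types (f : {poly R}) (t : R) (g : nat -> R) (n k N : nat).

Lemma exchange_triangle (F : nat -> nat -> R) N :
  \sum_(i < N) \sum_(r < i.+1) F i r = \sum_(r < N) \sum_(j < N - r) F (r + j)%N r.
Proof.
elim: N => [|N IH]; first by rewrite !big_ord0.
rewrite big_ord_recr IH /= [RHS]big_ord_recr /= subSnn big_ord1 addn0.
rewrite [X in _ + X]big_ord_recr /= addrA; congr (_ + _).
rewrite -big_split /=; apply: eq_bigr => r _.
by rewrite subSn 1?ltnW // big_ord_recr /= subnKC // ltnW.
Qed.

Lemma Taylor_at0 f t n : (size f <= n)%N ->
  f.[0] = \sum_(j < n) f^`(j).[t] * ((- t) ^+ j / j`!%:R).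
Proof.
move=> fn; have := @nderiv_taylor_wide _ n f t (- t) (mulrC _ _) fn.
rewrite subrr => ->; apply: eq_bigr => j _.
rewrite nderivn_def hornerMn -(mulr_natr _.[_]).
by field; rewrite fact_neq0.
Qed.

Lemma derivn_at0 f n : f^`(n).[0] = n`!%:R * f`_n.
Proof.
by rewrite horner_coef0 coef_derivn addn0 ffactnn -(mulr_natr _`_n) mulrC.
Qed.

(** For fixed [r] the sum over [i] is the Taylor expansion at [t] of the derivative of order
    [r + 1], evaluated at [0]. The index [i] stands for the order [i + 1]. *)
Lemma Taylor_resum g f t N : (size f <= N.+1)%N ->
  \sum_(i < N) (\sum_(r < i.+1) g r * ((- t) ^+ (i - r) / (i - r)`!%:R))
      * f^`(i.+1).[t]
  = \sum_(r < N) g r * (r.+1`!%:R * f`_r.+1).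
Proof.
move=> fN; under eq_bigr do rewrite mulr_suml.
rewrite (exchange_triangle (fun i r => g r * ((- t) ^+ (i - r) / (i - r)`!%:R)
   * f^`(i.+1).[t])).
apply: eq_bigr => r _; rewrite -derivn_at0 (@Taylor_at0 _ t (N - r)); last first.
  apply/leq_sizeP => j Nj; rewrite coef_derivn nth_default ?mul0rn //.
  by apply: leq_trans fN _; lia.
rewrite mulr_sumr; apply: eq_bigr => j _.
have -> : f^`(r.+1)^`(j) = f^`((r + j).+1).
  by rewrite /derivn -iterD addnS [(j + r)%N]addnC.
by rewrite addKn; ring.
Qed.

Lemma horner_extend (e : nat -> {poly R}) f N t : (size f <= N.+1)%N -> e 0%N = 0 ->
  (extend e f).[t] = \sum_(r < N) f`_r.+1 * (e r.+1).[t].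
Proof.
move=> fN e0; rewrite (extend_widen _ fN) big_ord_recl e0 scaler0 add0r.
by rewrite horner_sum; apply: eq_bigr => r _; rewrite hornerZ.
Qed.

End Taylor.

(** * From the explicit coefficients to the operators *)

Section CoefficientsAsOperators.
Variable R : realType.
Implicit Types (a b x t : R) (f : {poly R}) (n k i N : nat).

Lemma derivn_tvar f i : (f \Po tvar R)^`(i) = (2^-1 ^+ i) *: (f^`(i) \Po tvar R).
Proof.
elim: i => [|i IH]; first by rewrite expr0 scale1r !derivn0.
by rewrite derivnS IH derivZ deriv_tvar scalerA -exprSr derivnS.
Qed.

Lemma horner_tvar x : (tvar R).[x] = (x + 1) / 2.
Proof. by rewrite /tvar hornerZ hornerD hornerX hornerC mulrC. Qed.

Lemma derivn_tvar_horner f i x :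
  (f \Po tvar R)^`(i).[x] = (2^-1 ^+ i) * f^`(i).[(x + 1) / 2].
Proof. by rewrite derivn_tvar hornerZ horner_comp horner_tvar. Qed.

(** Brings [a_(i+1)] to the shape required by [Taylor_resum]; the power of [1 / 2] comes from
    [d/dx = (1 / 2) d/dt]. *)
Lemma coef_a_triangle a b i x : -1 < a -> -1 < b ->
  coef_a a b i.+1 x * 2^-1 ^+ i.+1 =
  \sum_(r < i.+1) ((imA a b r.+1).[(x + 1) / 2] / r.+1`!%:R)
     * ((- ((x + 1) / 2)) ^+ (i - r) / (i - r)`!%:R).
Proof.
move=> a1 b1; rewrite /coef_a; set t := (x + 1) / 2.
have pa := parama_gt0 a1.
have b3 : 0 < b + 3 by move: b1; lra.
pose F l k : R := (-1) ^+ l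
    * (poch (b + 3) (i - l) * poch (- b - 2) (i - l)
       / (poch (a + 1) (i - l) * (i.+1 - l)`!%:R * (i - l)`!%:R * l`!%:R))
    * hyp_term [:: - l%:R; a + b + 3; b + (i.+1 - l)%:R + 2]
          [:: a + (i.+1 - l)%:R; (i.+1 - l)%:R + 1] 1 k * t ^+ l.+1.
pose G r k : R := (poch (b + 3) r / poch (a + 1) r) *
   (t * (binr (- b - 2) (r - k) * binr (a + b + 3) k * t ^+ k)) / r.+1`!%:R
   * ((- t) ^+ (i - r) / (i - r)`!%:R).
have -> : \sum_(l < i.+1)
    (-1) ^+ l
    * (poch (b + 3) (i.+1 - l - 1) * poch (- b - 2) (i.+1 - l - 1)
       / (poch (a + 1) (i.+1 - l - 1)
          * (i.+1 - l)`!%:R * (i.+1 - l - 1)`!%:R * l`!%:R))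
    * pFq [:: - l%:R; a + b + 3; b + (i.+1 - l)%:R + 2]
          [:: a + (i.+1 - l)%:R; (i.+1 - l)%:R + 1] 1
    * t ^+ l.+1 = \sum_(l < i.+1) \sum_(k < l.+1) F l k.
  apply: eq_bigr => l _; rewrite pFq_terminating mulr_sumr mulr_suml.
  by apply: eq_bigr => k _; rewrite /F subn1 subSn -1?ltnS.
have -> : \sum_(r < i.+1) ((imA a b r.+1).[t] / r.+1`!%:R)
     * ((- t) ^+ (i - r) / (i - r)`!%:R)
   = - (a + b + 2) * \sum_(r < i.+1) \sum_(k < r.+1) G r k.
  rewrite mulr_sumr; apply: eq_bigr => r _.
  rewrite /imA hornerZ hornerM hornerX horner_poly !mulr_sumr !mulr_suml.
  by apply: eq_bigr => k _; rewrite /G; ring.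
rewrite mulrAC -[- _ * 2 ^+ _ * _]mulrA -exprMn divff ?pnatr_eq0 // expr1n mulr1.
congr (_ * _); rewrite !exchange_triangle; apply: eq_bigr => k _.
(* The terms are matched by [l = k + j] on the left and [r = i - j] on the right, so that
   [w = i - l = r - k]. *)
rewrite [RHS](reindex_inj rev_ord_inj); apply: eq_bigr => j _ /=.
have ji : (k + j <= i)%N by have := ltn_ord j; have := ltn_ord k; lia.
have [w Ew] : exists w, i = (k + j + w)%N by exists (i - (k + j))%N; rewrite subnKC.
have -> : (k + (i.+1 - k - j.+1) = w + k)%N by lia.
rewrite /F /G.
have -> : (i - (k + j) = w)%N by lia.
have -> : (i.+1 - (k + j) = w.+1)%N by lia.
have -> : (i - (w + k) = j)%N by lia.
rewrite addnK /hyp_term !big_cons !big_nil !mulr1 expr1n.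
rewrite pochN_fact leq_addr addKn natr1 poch_fact.
have -> : b + w.+1%:R + 2 = b + 3 + w%:R by rewrite -natr1; ring.
have -> : a + w.+1%:R = a + 1 + w%:R by rewrite -natr1; ring.
rewrite !pochD /binr -[(w + k).+1]addSn [(- t) ^+ j]exprNn !exprD !exprS exprD.
have aw : 0 < a + 1 + w%:R by rewrite ltr_wpDr ?ler0n.
have S : (-1) ^+ k * (-1) ^+ k = 1 :> R by rewrite -expr2 sqrr_sign.
have h1 := poch_neq0 w pa; have h2 := poch_neq0 k aw.
(* The left side contains [(-1)^k] twice, from [(-1)^l] and from [(-l)_k]; the same square is put on
   the right. *)
rewrite -[RHS]mul1r -[X in _ = X * _]S.
by field; rewrite h1 h2 !fact_neq0.
Qed.

Lemma opA_coef a b f N x : -1 < a -> -1 < b -> (size f <= N.+1)%N ->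
  \sum_(i < N) coef_a a b i.+1 x * (f \Po tvar R)^`(i.+1).[x]
  = (opA a b f).[(x + 1) / 2].
Proof.
move=> a1 b1 fN; rewrite (horner_extend _ fN) //.
under eq_bigr do rewrite derivn_tvar_horner mulrA coef_a_triangle //.
rewrite (Taylor_resum (fun r => (imA a b r.+1).[(x + 1) / 2] / r.+1`!%:R)) //.
by apply: eq_bigr => r _; field; rewrite fact_neq0.
Qed.

Lemma coef_b_mir a b i x : coef_b a b i x = (-1) ^+ i * coef_a b a i (- x).
Proof.
rewrite /coef_b /coef_a [b + a]addrC.
have -> : (-2 : R) ^+ i = (-1) ^+ i * 2 ^+ i by rewrite -exprMn mulN1r.
set Z := \sum_(l < i) _; set Z' := (X in _ = _ * (_ * X)).
suff -> : Z' = - Z by ring.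
rewrite /Z -sumrN; apply: eq_bigr => l _.
have -> : (- x + 1) / 2 = - ((x - 1) / 2) by field.
have -> : (- ((x - 1) / 2)) ^+ l.+1 = - ((-1) ^+ l * ((x - 1) / 2) ^+ l.+1).
  by rewrite [LHS]exprNn [(-1) ^+ l.+1]exprS mulN1r mulNr.
have S : (-1) ^+ l * (-1) ^+ l = 1 :> R by rewrite -expr2 sqrr_sign.
by rewrite -[RHS]mul1r -[X in _ = X * _]S; ring.
Qed.

(** The commutator of [D^i] with [t] is [i D^(i-1)]; the factor [i = v + 2] cancels the [1 / i] in
    [coef_c1] and leads to [imE]. *)
Lemma coef_c1_triangle a b v x : -1 < a -> -1 < b ->
  v.+2%:R * (coef_c1 a b v.+2 x * 2^-1 ^+ v.+2) =
  \sum_(r < v.+1) ((imE a b r.+1).[(x + 1) / 2] / r.+1`!%:R)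
     * ((- ((x + 1) / 2)) ^+ (v - r) / (v - r)`!%:R).
Proof.
move=> a1 b1; rewrite /coef_c1 subSS subSS subn0 -pred_Sn.
have xt : x = 2 * ((x + 1) / 2) - 1 by field.
set t := (x + 1) / 2 in xt *.
have b3 : 0 < b + 3 by move: b1; lra.
pose F l k : R := (-1) ^+ l
    * (poch (b + 3) (v - l) * poch (- a - b - 3) (v - l)
       / ((v.+1 - l)`!%:R * (v - l)`!%:R * l`!%:R * (v.+1 - l)`!%:R))
    * hyp_term [:: - l%:R; a + b + 5; a + b + 4; b + (v.+2 - l)%:R + 1]
          [:: b + 3; (v.+2 - l)%:R; (v.+2 - l)%:R] 1 k * t ^+ l.+1.
pose G r k : R := poch (b + 3) r / r.+1`!%:R *
   (t * (binr (- a - b - 3) (r - k)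
        * (poch (a + b + 5) k * poch (a + b + 4) k / (poch (b + 3) k * k`!%:R)) * t ^+ k)) / r.+1`!%:R
   * ((- t) ^+ (v - r) / (v - r)`!%:R).
have -> : \sum_(l < v.+1)
    (-1) ^+ l
    * (poch (b + 3) (v.+2 - l - 2) * poch (- a - b - 3) (v.+2 - l - 2)
       / ((v.+2 - l - 1)`!%:R * (v.+2 - l - 2)`!%:R * l`!%:R * (v.+2 - l - 1)`!%:R))
    * pFq [:: - l%:R; a + b + 5; a + b + 4; b + (v.+2 - l)%:R + 1]
          [:: b + 3; (v.+2 - l)%:R; (v.+2 - l)%:R] 1
    * t ^+ l.+1 = \sum_(l < v.+1) \sum_(k < l.+1) F l k.
  apply: eq_bigr => l _; rewrite pFq_terminating mulr_sumr mulr_suml.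
  apply: eq_bigr => k _; rewrite /F.
  have lv := ltn_ord l.
  have -> : (v.+2 - l - 2 = v - l)%N by lia.
  by have -> : (v.+2 - l - 1 = v.+1 - l)%N by lia.
have -> : \sum_(r < v.+1) ((imE a b r.+1).[t] / r.+1`!%:R)
     * ((- t) ^+ (v - r) / (v - r)`!%:R)
   = constC a b * t * (1 - t) * \sum_(r < v.+1) \sum_(k < r.+1) G r k.
  rewrite mulr_sumr; apply: eq_bigr => r _.
  rewrite /imE hornerZ !hornerM hornerU hornerX horner_poly !mulr_sumr !mulr_suml.
  by apply: eq_bigr => k _; rewrite /G; ring.
have -> : \sum_(l < v.+1) \sum_(k < l.+1) F l k = \sum_(r < v.+1) \sum_(k < r.+1) G r k.
  rewrite !exchange_triangle; apply: eq_bigr => k _.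
  rewrite [RHS](reindex_inj rev_ord_inj); apply: eq_bigr => j _ /=.
  have jv : (k + j <= v)%N by have := ltn_ord j; have := ltn_ord k; lia.
  have [w Ew] : exists w, v = (k + j + w)%N by exists (v - (k + j))%N; rewrite subnKC.
  have -> : (k + (v.+1 - k - j.+1) = w + k)%N by lia.
  rewrite /F /G.
  have -> : (v - (k + j) = w)%N by lia.
  have -> : (v.+1 - (k + j) = w.+1)%N by lia.
  have -> : (v.+2 - (k + j) = w.+2)%N by lia.
  have -> : (v - (w + k) = j)%N by lia.
  rewrite addnK /hyp_term !big_cons !big_nil !mulr1 expr1n.
  rewrite pochN_fact leq_addr addKn !poch_fact.
  have -> : b + w.+2%:R + 1 = b + 3 + w%:R by rewrite -!natr1; ring.
  rewrite !pochD /binr -[(w + k).+1]addSn [(- t) ^+ j]exprNn !exprD !exprS exprD.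
  have S : (-1) ^+ k * (-1) ^+ k = 1 :> R by rewrite -expr2 sqrr_sign.
  have h1 := poch_neq0 k b3.
  rewrite -[RHS]mul1r -[X in _ = X * _]S.
  by field; rewrite h1 !fact_neq0.
move: (\sum_(r < v.+1) _) => Z; rewrite xt /constC.
have h1 : a + 1 != 0 by rewrite gt_eqF ?parama_gt0.
have h2 : b + 1 != 0 by rewrite gt_eqF ?paramb_gt0.
have E2 : (2 : R) ^+ v * (2^-1) ^+ v = 1 by rewrite -exprMn divff ?pnatr_eq0 // expr1n.
rewrite [2^-1 ^+ _]exprS [2^-1 ^+ v.+1]exprS -[RHS]mulr1 -[X in _ = _ * X]E2.
by field; rewrite h1 h2 nat2S_neq0.
Qed.

Definition coef_c1' a b i x : R := if (i <= 1)%N then 0 else coef_c1 a b i x.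

(** Induction along the recursion of [imC]: by Leibniz' rule the factor [t] splits off, and the
    remaining sum, weighted with the orders, is resummed to [imE]. *)
Lemma opC1_coefXn a b n N x : -1 < a -> -1 < b -> (n <= N)%N ->
  \sum_(i < N) coef_c1' a b i.+1 x * 2^-1 ^+ i.+1 * ('X^n)^`(i.+1).[(x + 1) / 2]
  = (imC a b n).[(x + 1) / 2].
Proof.
move=> a1 b1; set t := (x + 1) / 2; elim: n => [|n IH] nN.
  rewrite horner0 big1 // => i _.
  by rewrite expr0 -polyC1 derivnC /= horner0 mulr0.
have D i : ('X^(n.+1) : {poly R})^`(i.+1).[t] =
    t * ('X^n)^`(i.+1).[t] + i.+1%:R * ('X^n)^`(i).[t].
  rewrite exprSr -['X^n * 'X]addr0 -[0 : {poly R}]/(0%:P) derivnMXaddC hornerD hornerMn.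
  by rewrite hornerM hornerX -mulr_natl; ring.
transitivity (t * \sum_(i < N) coef_c1' a b i.+1 x * 2^-1 ^+ i.+1 * ('X^n)^`(i.+1).[t]
  + \sum_(i < N) i.+1%:R * (coef_c1' a b i.+1 x * 2^-1 ^+ i.+1) * ('X^n)^`(i).[t]).
  rewrite mulr_sumr -big_split /=; apply: eq_bigr => i _.
  by rewrite D; ring.
rewrite IH 1?ltnW //= hornerD hornerM hornerX; congr (_ + _).
case: N nN {IH} => // N nN.
(* The term of order one vanishes; the coefficients of order [v + 2] are paired with derivatives of
   order [v + 1]. *)
rewrite big_ord_recl {1}/coef_c1' /= mul0r mulr0 mul0r add0r.
rewrite -opEXn (@horner_extend _ _ _ N) ?size_polyXn //.
transitivity (\sum_(v < N) (\sum_(r < v.+1) ((imE a b r.+1).[t] / r.+1`!%:R)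
     * ((- t) ^+ (v - r) / (v - r)`!%:R)) * ('X^n)^`(v.+1).[t]).
  apply: eq_bigr => v _; rewrite /bump /= add1n /coef_c1' /=.
  by rewrite coef_c1_triangle.
rewrite (Taylor_resum (fun r => (imE a b r.+1).[t] / r.+1`!%:R)) ?size_polyXn //.
by apply: eq_bigr => r _; field; rewrite fact_neq0.
Qed.

Lemma poly_widen f N : (size f <= N)%N -> f = \sum_(r < N) f`_r *: 'X^r.
Proof.
move=> fN; rewrite -(extend_widen (fun r => 'X^r) fN) /extend -poly_def.
by rewrite coefK.
Qed.

Lemma derivn_sum_ord n N (F : 'I_N -> {poly R}) :
  (\sum_(i < N) F i)^`(n) = \sum_(i < N) (F i)^`(n).
Proof. exact: linear_sum. Qed.

Lemma opC1_coef a b f N x : -1 < a -> -1 < b -> (size f <= N.+1)%N ->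
  \sum_(i < N) coef_c1' a b i.+1 x * (f \Po tvar R)^`(i.+1).[x]
  = (opC1 a b f).[(x + 1) / 2].
Proof.
move=> a1 b1 fN; rewrite /opC1 (extend_widen _ fN) horner_sum.
under [RHS]eq_bigr => r _.
  rewrite hornerZ -(@opC1_coefXn a b r N x) // 1?mulr_sumr; last by rewrite -ltnS.
  over.
rewrite exchange_big; apply: eq_bigr => i _.
rewrite derivn_tvar_horner [in LHS](poly_widen fN) derivn_sum_ord horner_sum.
rewrite !mulr_sumr; apply: eq_bigr => r _; rewrite derivnZ hornerZ.
by ring.
Qed.

Lemma derivn_mir f i : (mir f)^`(i) = (-1) ^+ i *: mir f^`(i).
Proof.
elim: i => [|i IH]; first by rewrite scale1r !derivn0.
by rewrite !derivnS IH derivZ deriv_mir exprSr -scalerA scaleN1r.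
Qed.

Lemma mir_coef_sum (c : nat -> R -> R) f N x :
  \sum_(i < N) ((-1) ^+ i.+1 * c i.+1 (- x)) * (f \Po tvar R)^`(i.+1).[x]
  = \sum_(i < N) c i.+1 (- x) * (mir f \Po tvar R)^`(i.+1).[- x].
Proof.
apply: eq_bigr => i _; rewrite !derivn_tvar_horner derivn_mir hornerZ horner_mir.
have -> : 1 - (- x + 1) / 2 = (x + 1) / 2 by field.
by ring.
Qed.

Lemma opB_coef a b f N x : -1 < a -> -1 < b -> (size f <= N.+1)%N ->
  \sum_(i < N) coef_b a b i.+1 x * (f \Po tvar R)^`(i.+1).[x]
  = (opB a b f).[(x + 1) / 2].
Proof.
move=> a1 b1 fN; under eq_bigr do rewrite coef_b_mir.
rewrite (mir_coef_sum (coef_a b a)) opA_coef ?size_mir // /opB horner_mir.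
by congr (_.[_]); field.
Qed.

Lemma coef_c2_mir a b i x : (1 < i)%N ->
  coef_c2 a b i x = (-1) ^+ i * coef_c1 b a i (- x).
Proof.
case: i => [|[|i]] // _; rewrite /coef_c2 /coef_c1 [b + a]addrC !subSS subn0.
have -> : (-2 : R) ^+ i = (-1) ^+ i.+2 * 2 ^+ i by rewrite !exprS !mulN1r opprK -exprMn mulN1r.
rewrite [(b + 1) * (a + 1)]mulrC sqrrN.
set Z := \sum_(l < _) _; set Z' := (X in _ = _ * (_ * X)).
suff -> : Z' = - Z by ring.
rewrite /Z -sumrN; apply: eq_bigr => l _.
have -> : (- x + 1) / 2 = - ((x - 1) / 2) by field.
have -> : (- ((x - 1) / 2)) ^+ l.+1 = - ((-1) ^+ l * ((x - 1) / 2) ^+ l.+1).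
  by rewrite [LHS]exprNn [(-1) ^+ l.+1]exprS mulN1r mulNr.
have -> : - b - a - 3 = - a - b - 3 by ring.
have S : (-1) ^+ l * (-1) ^+ l = 1 :> R by rewrite -expr2 sqrr_sign.
by rewrite -[RHS]mul1r -[X in _ = X * _]S; ring.
Qed.

Lemma opC_coef a b f N x : -1 < a -> -1 < b -> (size f <= N.+1)%N ->
  \sum_(i < N) coef_c a b i.+1 x * (f \Po tvar R)^`(i.+1).[x]
  = (opC a b f).[(x + 1) / 2].
Proof.
move=> a1 b1 fN.
have E i : coef_c a b i x = coef_c1' a b i x + (-1) ^+ i * coef_c1' b a i (- x).
  rewrite /coef_c /coef_c1'; case: leqP => i1; first by rewrite mulr0 addr0.
  by rewrite coef_c2_mir.
under eq_bigr do rewrite E mulrDl.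
rewrite big_split /= (mir_coef_sum (coef_c1' b a)) !opC1_coef ?size_mir //.
rewrite /opC hornerD horner_mir; congr (_ + _.[_]).
by field.
Qed.

End CoefficientsAsOperators.

(** * The differential equation *)

Section Existence.
Variable R : realType.
Implicit Types (a b x : R) (f : {poly R}).

Lemma size_comp_tvar f : size (f \Po tvar R) = size f.
Proof.
rewrite size_comp_poly2 // /tvar size_scale ?invr_eq0 ?pnatr_eq0 //.
by rewrite -[1]opprK -polyCN size_XsubC.
Qed.

(** The eigenvalue equation [opM_tY], evaluated at [t = (x + 1) / 2]. *)
Lemma coef_satisfies a b : -1 < a -> -1 < b ->
  satisfies_diff_eq a b (coef_a0 a b) (coef_b0 a b) (coef_c0 a b)
    (coef_a a b) (coef_b a b) (coef_c a b).
Proof.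
move=> a1 b1 M N n x M0 N0 /=; rewrite gen_jacobi_tvar !diff_opE size_comp_tvar.
set Y := tY a b M N n; rewrite !big_add1 !big_mkord.
rewrite opA_coef ?opB_coef ?opC_coef //.
have -> : (Y \Po tvar R)^`(2).[x] = 2^-1 ^+ 2 * Y^`()^`().[(x + 1) / 2].
  by rewrite derivn_tvar_horner.
have -> : (Y \Po tvar R)^`().[x] = 2^-1 * Y^`().[(x + 1) / 2].
  by rewrite -derivn1 derivn_tvar_horner expr1 derivn1.
rewrite horner_comp horner_tvar.
have := congr1 (horner^~ ((x + 1) / 2)) (opM_tY n a1 b1 M0 N0).
rewrite opM_horner hornerZ -/Y.
have -> : (jacL a b Y).[(x + 1) / 2] = (1 - x ^+ 2) * (2^-1 ^+ 2 * Y^`()^`().[(x + 1) / 2])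
   + (b - a - (a + b + 2) * x) * (2^-1 * Y^`().[(x + 1) / 2]).
  rewrite /jacL hornerD !hornerM hornerU hornerX hornerD hornerN !hornerM !hornerX !hornerC.
  by field.
rewrite /jlam => /eqP; rewrite -subr_eq0 => /eqP E.
by rewrite -[RHS]E; ring.
Qed.

End Existence.

(** * Uniqueness of the coefficients *)

Section Uniqueness.
Variable R : realType.
Implicit Types (x : R) (f g : {poly R}) (d : nat -> R) (c : nat -> R -> R) (n : nat).

(** Truncation at order [n] makes linearity in [f] immediate, without limits; for degree at most [n]
    it agrees with [diff_op]. *)
Definition finite_op d c n f x : R :=
  d n * f.[x] + \sum_(1 <= i < n.+1) c i x * f^`(i).[x].

Lemma diff_op_finite d c n f x : (size f <= n.+1)%N ->
  diff_op d c n f x = finite_op d c n f x.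
Proof.
move=> fn; rewrite /diff_op (@limn_big_finite _ 1 n.+1) // => k nk.
by rewrite derivn_poly0 ?horner0 ?mulr0 // (leq_trans fn).
Qed.

Lemma finite_opD d c n f g x :
  finite_op d c n (f + g) x = finite_op d c n f x + finite_op d c n g x.
Proof.
rewrite /finite_op hornerD mulrDr addrACA -big_split /=; congr (_ + _).
by apply: eq_bigr => i _; rewrite derivnD hornerD mulrDr.
Qed.

Lemma finite_opZ d c n k f x :
  finite_op d c n (k *: f) x = k * finite_op d c n f x.
Proof.
rewrite /finite_op hornerZ mulrDr mulrCA mulr_sumr; congr (_ + _).
by apply: eq_bigr => i _; rewrite derivnZ hornerZ mulrCA.
Qed.

Lemma finite_opB d d' c c' n f x :
  finite_op (fun n => d n - d' n) (fun i x => c i x - c' i x) n f x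
  = finite_op d c n f x - finite_op d' c' n f x.
Proof.
rewrite /finite_op mulrBl opprD addrACA -sumrB; congr (_ + _).
by apply: eq_bigr => i _; rewrite mulrBl.
Qed.

Lemma derivn_lead f n x : (size f <= n.+1)%N -> f^`(n).[x] = n`!%:R * f`_n.
Proof.
move=> fn; rewrite (_ : f^`(n) = ((f^`(n))`_0)%:P) ?hornerC.
  by rewrite coef_derivn addn0 ffactnn mulr_natl.
apply: size1_polyC; apply/leq_sizeP => j j0.
by rewrite coef_derivn nth_default ?mul0rn // (leq_trans fn) // -addn1 leq_add2l.
Qed.

(** By induction only [d n] and [c n] are left in the equations for [P n] and [Q n]. If [d n] were
    nonzero, the second equation at [z1] would give [c n z1 = 0], against the first one at [z1], or
    a zero top coefficient of [Q n], against its value at [z2]. Then [c n] vanishes because [P n]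
    has degree [n]. *)
Lemma finite_op_unique (P Q : nat -> {poly R}) (z1 z2 : R) d c :
  (forall n, size (P n) = n.+1) -> (forall n, (size (Q n) <= n.+1)%N) ->
  (forall n, (P n).[z1] != 0) -> (forall n, (Q n).[z1] = 0) ->
  (forall n, (0 < n)%N -> (Q n).[z2] != 0) ->
  (forall n x, finite_op d c n (P n) x = 0) ->
  (forall n x, finite_op d c n (Q n) x = 0) ->
  forall n, d n = 0 /\ ((0 < n)%N -> forall x, c n x = 0).
Proof.
move=> sP sQ P1 Q1 Q2 EP EQ; elim/ltn_ind => n IH.
case: n IH => [|m] IH.
  split=> //; have := EP 0%N z1; rewrite /finite_op big_geq // addr0 => /eqP.
  by rewrite mulf_eq0 (negPf (P1 _)) orbF => /eqP.
have E f x : (size f <= m.+2)%N -> finite_op d c m.+1 f x = 0 ->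
    d m.+1 * f.[x] + c m.+1 x * (m.+1`!%:R * f`_m.+1) = 0.
  move=> sf; rewrite /finite_op big_nat_recr //.
  rewrite [X in _ + (X + _)]big_nat big1 ?add0r; last first.
    by move=> i /andP [i0 im]; rewrite (IH i _).2 // mul0r.
  by rewrite derivn_lead.
have EP' x := E _ x (eq_leq (sP m.+1)) (EP m.+1 x).
have EQ' x := E _ x (sQ m.+1) (EQ m.+1 x).
have p0 : m.+1`!%:R * (P m.+1)`_m.+1 != 0.
  have : lead_coef (P m.+1) != 0 by rewrite lead_coef_eq0 -size_poly_eq0 sP.
  by rewrite lead_coefE sP mulf_eq0 (negPf (fact_neq0 _ _)).
have dm0 : d m.+1 = 0.
  apply/eqP; apply: contraT => dn.
  have := EQ' z1; rewrite Q1 mulr0 add0r => /eqP; rewrite mulf_eq0 => /orP [] /eqP Z.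
    have := EP' z1; rewrite Z mul0r addr0 => /eqP.
    by rewrite mulf_eq0 (negPf dn) (negPf (P1 _)).
  have := EQ' z2; rewrite Z mulr0 addr0 => /eqP.
  by rewrite mulf_eq0 (negPf dn) (negPf (Q2 _ _)).
split=> // _ x; have := EP' x; rewrite dm0 mul0r add0r => /eqP.
by rewrite mulf_eq0 (negPf p0) orbF => /eqP.
Qed.

End Uniqueness.

Section MainTheorem.
Variable R : realType.
Variables (a b : R).
Hypotheses (a1 : -1 < a) (b1 : -1 < b).

Let xP n := tjac a b n \Po tvar R.
Let xQ n := tQ a b n \Po tvar R.
Let xR n := tR a b n \Po tvar R.
Let xS n := tS a b n \Po tvar R.

Let at1 f : (f \Po tvar R).[1] = f.[1].
Proof.
rewrite horner_comp horner_tvar.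
by have -> : (1 + 1) / 2 = 1 :> R by field.
Qed.

Let atN1 f : (f \Po tvar R).[-1] = f.[0].
Proof. by rewrite horner_comp horner_tvar addNr mul0r. Qed.

Lemma tY_split M N n x (d : nat -> R) c :
  finite_op d c n (tY a b M N n \Po tvar R) x =
  finite_op d c n (xP n) x + M * finite_op d c n (xQ n) x
  + N * finite_op d c n (xR n) x + M * N * finite_op d c n (xS n) x.
Proof. by rewrite /tY !comp_polyD !comp_polyZ !finite_opD !finite_opZ. Qed.

Lemma tjac_at_neq0 n : (tjac a b n).[0] != 0 /\ (tjac a b n).[1] != 0.
Proof.
rewrite tjac_at0 // tjac_at1 !mulf_neq0 ?signr_eq0 ?invr_eq0 ?fact_neq0 //;
  by rewrite poch_neq0 ?parama_gt0 ?paramb_gt0.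
Qed.

Lemma size_tY_parts n : [/\ size (tjac a b n) = n.+1,
  (size (tQ a b n) <= n.+1)%N & (size (tR a b n) <= n.+1)%N].
Proof.
have sP := size_tjac n a1 b1; split=> //.
- have := size_tY 1 0 n a1 b1; rewrite /tY mulr0 !scale0r !addr0 scale1r => H.
  rewrite -[tQ a b n](addKr (tjac a b n)); apply: size_add_leq => //.
  by rewrite size_polyN sP.
- have := size_tY 0 1 n a1 b1; rewrite /tY mul0r !scale0r !addr0 scale1r => H.
  rewrite -[tR a b n](addKr (tjac a b n)); apply: size_add_leq => //.
  by rewrite size_polyN sP.
Qed.

Lemma diff_eq_unique (da db dc da' db' dc' : nat -> R) (ca cb cc ca' cb' cc' : nat -> R -> R) :
  satisfies_diff_eq a b da db dc ca cb cc ->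
  satisfies_diff_eq a b da' db' dc' ca' cb' cc' ->
  (forall n, da' n = da n /\ db' n = db n /\ dc' n = dc n) /\
  (forall i x, (1 <= i)%N -> ca' i x = ca i x /\ cb' i x = cb i x /\ cc' i x = cc i x).
Proof.
move=> H H'.
pose fa := finite_op (fun n => da' n - da n) (fun i x => ca' i x - ca i x).
pose fb := finite_op (fun n => db' n - db n) (fun i x => cb' i x - cb i x).
pose fc := finite_op (fun n => dc' n - dc n) (fun i x => cc' i x - cc i x).
have E (M N : R) n x : 0 <= M -> 0 <= N ->
  M * (fa n (xP n) x + M * fa n (xQ n) x + N * fa n (xR n) x + M * N * fa n (xS n) x)
  + N * (fb n (xP n) x + M * fb n (xQ n) x + N * fb n (xR n) x + M * N * fb n (xS n) x)
  + M * N * (fc n (xP n) x + M * fc n (xQ n) x + N * fc n (xR n) x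
             + M * N * fc n (xS n) x) = 0.
  move=> M0 N0; have := H M N n x M0 N0; have := H' M N n x M0 N0 => /=.
  have sY : (size (gen_jacobi a b M N n) <= n.+1)%N.
    by rewrite gen_jacobi_tvar size_comp_tvar size_tY.
  rewrite !diff_op_finite // => E' E.
  rewrite -!tY_split -gen_jacobi_tvar !finite_opB -[RHS](subrr (0 : R)).
  by rewrite -[X in _ = X - _]E' -[X in _ = _ - X]E; ring.
have u0 : 0 <= 0 :> R by []. have u1 : 0 <= 1 :> R by exact: ler01.
have u2 : 0 <= 2 :> R by exact: ler0n.
have ne n := tjac_at_neq0 n; have sz n := size_tY_parts n.
have sP n : size (xP n) = n.+1 by rewrite size_comp_tvar; case: (sz n).
have sQ n : (size (xQ n) <= n.+1)%N by rewrite size_comp_tvar; case: (sz n).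
have sR n : (size (xR n) <= n.+1)%N by rewrite size_comp_tvar; case: (sz n).
have Q1 n : (0 < n)%N -> (xQ n).[1] != 0.
  move=> n0; rewrite at1 tQ_at1 //.
  apply: mulf_neq0; first by rewrite gt_eqF ?kQ_gt0.
  by apply: mulf_neq0; [rewrite gt_eqF ?jlam_gt0|case: (ne n)].
have R0 n : (0 < n)%N -> (xR n).[-1] != 0.
  move=> n0; rewrite atN1 tR_at0 //.
  apply: mulf_neq0; first by rewrite gt_eqF ?kQ_gt0.
  by apply: mulf_neq0; [rewrite gt_eqF ?jlam_gt0|case: (ne n)].
have P0 n : (xP n).[-1] != 0 by rewrite atN1 (ne n).1.
have P1 n : (xP n).[1] != 0 by rewrite at1 (ne n).2.
have Q0 n : (xQ n).[-1] = 0 by rewrite atN1 tQ_at0.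
have R1 n : (xR n).[1] = 0 by rewrite at1 tR_at1.
(* For [N = 0] the identity [E] is a quadratic in [M] without constant term; the values [M = 1, 2]
   separate the parts of [P_n] and [Q_n]. *)
have UA : forall n, da' n - da n = 0 /\ ((0 < n)%N -> forall x, ca' n x - ca n x = 0).
  apply: (@finite_op_unique _ xP xQ (-1) 1) => // n x; rewrite -/fa;
  have := E 1 0 n x u1 u0; have := E 2 0 n x u2 u0; lra.
have UB : forall n, db' n - db n = 0 /\ ((0 < n)%N -> forall x, cb' n x - cb n x = 0).
  apply: (@finite_op_unique _ xP xR 1 (-1)) => // n x; rewrite -/fb;
  have := E 0 1 n x u0 u1; have := E 0 2 n x u0 u2; lra.
have Z d c n f x : (forall n, d n = 0 /\ ((0 < n)%N -> forall x, c n x = 0)) ->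
    finite_op d c n f x = 0 :> R.
  move=> Hd; rewrite /finite_op (Hd n).1 mul0r add0r big_nat big1 // => i /andP [i0 _].
  by rewrite (Hd i).2 // mul0r.
(* Once the differences of the [a] and [b] coefficients vanish, [E] can be divided by [M N]. *)
have EC (M N : R) n x : 0 < M -> 0 < N -> fc n (xP n) x + M * fc n (xQ n) x + N * fc n (xR n) x
             + M * N * fc n (xS n) x = 0.
  move=> M0 N0; have := E M N n x (ltW M0) (ltW N0).
  rewrite /fa /fb !(Z _ _ _ _ _ UA) !(Z _ _ _ _ _ UB) !mulr0 !addr0 !mulr0 !add0r => /eqP.
  by rewrite mulf_eq0 (gt_eqF (mulr_gt0 M0 N0)) /= => /eqP.
(* An expression of degree one in each of [M] and [N] is determined by its values at the four points
   with coordinates [1] and [2]. *)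
have UC : forall n, dc' n - dc n = 0 /\ ((0 < n)%N -> forall x, cc' n x - cc n x = 0).
  apply: (@finite_op_unique _ xP xQ (-1) 1) => // n x; rewrite -/fc;
  have := EC 1 1 n x ltr01 ltr01; have := EC 2 1 n x (ltr0n _ 2) ltr01;
  have := EC 1 2 n x ltr01 (ltr0n _ 2); have := EC 2 2 n x (ltr0n _ 2) (ltr0n _ 2);
  rewrite !mul1r; lra.
split=> [n|i x i1].
  by split; [|split]; apply/eqP; rewrite -subr_eq0 ?(UA n).1 ?(UB n).1 ?(UC n).1.
by split; [|split]; apply/eqP; rewrite -subr_eq0 ?(UA i).2 ?(UB i).2 ?(UC i).2.
Qed.

End MainTheorem.

Unset Implicit Arguments.

Theorem mainTheorem1 (R : realType) (alpha beta : R)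
    (halpha : -1 < alpha) (hbeta : -1 < beta) :
  exists (a0 b0 c0 : nat -> R) (a b c : nat -> R -> R),
    satisfies_diff_eq alpha beta a0 b0 c0 a b c
    /\ (forall (a0' b0' c0' : nat -> R) (a' b' c' : nat -> R -> R),
          satisfies_diff_eq alpha beta a0' b0' c0' a' b' c' ->
          (forall n : nat, a0' n = a0 n /\ b0' n = b0 n /\ c0' n = c0 n)
          /\ (forall (i : nat) (x : R), (1 <= i)%N ->
                a' i x = a i x /\ b' i x = b i x /\ c' i x = c i x))
    /\ (forall n : nat, a0 n = coef_a0 alpha beta n
                        /\ b0 n = coef_b0 alpha beta n
                        /\ c0 n = coef_c0 alpha beta n)
    /\ (forall (i : nat) (x : R), (1 <= i)%N ->
          a i x = coef_a alpha beta i x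
          /\ b i x = coef_b alpha beta i x
          /\ c i x = coef_c alpha beta i x).
Proof.
have sat := coef_satisfies halpha hbeta.
exists (coef_a0 alpha beta), (coef_b0 alpha beta), (coef_c0 alpha beta).
exists (coef_a alpha beta), (coef_b alpha beta), (coef_c alpha beta).
split; first exact: sat.
split; last by do !split.
by move=> *; apply: (diff_eq_unique halpha hbeta sat).
Qed.
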